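(* Consider the standard stochastic gradient recursion $\boldsymbol x_i=\boldsymbol x_{i-1}-\mu\nabla_wQ(\boldsymbol x_{i-1};\boldsymbol\theta_i)$, $i\ge0$, and the momentum stochastic gradient recursion with step-size $\mu_m$ (see context), started from the same initial states, $\boldsymbol\psi_{-2}=\boldsymbol w_{-2}=\boldsymbol x_{-1}$. Assume: (i) $J$ is twice differentiable with $0<\nu I_M\le\nabla^2J(w)\le\delta I_M$ for all $w$; (ii) for every $\mathcal F_{i-1}$-measurable random vector $\boldsymbol w$, almost surely, $\mathbb E[\boldsymbol s_i(\boldsymbol w)\mid\mathcal F_{i-1}]=0$ and $\mathbb E[\|\boldsymbol s_i(\boldsymbol w)\|^4\mid\mathcal F_{i-1}]\le\gamma_4^4\|w^o-\boldsymbol w\|^4+\sigma_{s,4}^4$ with nonnegative constants $\gamma_4^4,\sigma_{s,4}^4$; (iii) $\beta_1,\beta_2\in[0,1)$ satisfy $\beta_1+\beta_2=\beta$, $\beta_1\beta_2=0$, where $\beta\in[0,1)$ is a constant with $\beta\le1-\epsilon$ for some fixed $\epsilon>0$; (iv) $\mu=\frac{\mu_m}{1-\beta}$; (v) for some constants $\xi_1,\xi_2$ and all $i\ge0$, $$\mathbb E[\|\boldsymbol s_i(\boldsymbol\psi_{i-1})-\boldsymbol s_i(\boldsymbol x_{i-1})\|^2\mid\mathcal F_{i-1}]\le\xi_1\|\boldsymbol\psi_{i-1}-\boldsymbol x_{i-1}\|^2,\quad \mathbb E[\|\boldsymbol s_i(\boldsymbol\psi_{i-1})-\boldsymbol s_i(\boldsymbol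 x_{i-1})\|^4\mid\mathcal F_{i-1}]\le\xi_2\|\boldsymbol\psi_{i-1}-\boldsymbol x_{i-1}\|^4;$$ (vi) the Hessian is Lipschitz: $\|\nabla_w^2J(w_1)-\nabla_w^2J(w_2)\|\le\kappa\|w_1-w_2\|$ for all $w_1,w_2$ in the domain of $J$ and some constant $\kappa\ge0$. Then, for sufficiently small $\mu$, $$\mathbb E\|\widetilde{\boldsymbol w}_i-\widetilde{\boldsymbol x}_i\|^2=O\left(\frac{\delta^2\sigma_s^2\,i^2\,\tau_2^{\,i+1}\mu^{3/2}}{(1-\beta)\nu^{5/2}}+\left[\frac{(\delta^2+\gamma^2)\rho_1^{\,i+1}}{(1-\beta)^2}+\frac{\delta^2\sigma_s^4}{(1-\beta)\nu^2}\right]\mu^2\right),\qquad\forall\,i=0,1,2,3,\dots,$$ where $\rho_1=1-\frac{\mu\nu}{2}\in(0,1)$ and $\tau_2=\sqrt{1-\mu\nu/4}\in(0,1)$.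
   Context: $J(w)=\mathbb E_{\boldsymbol\theta}[Q(w;\boldsymbol\theta)]$, $w\in\mathbb R^M$, where $Q$ is a loss function, $\boldsymbol\theta$ random data and $\boldsymbol\theta_i$ streaming samples of it; $w^o=\arg\min_wJ(w)$. Gradient noise: $\boldsymbol s_i(\boldsymbol w)=\nabla_wQ(\boldsymbol w;\boldsymbol\theta_i)-\nabla_wJ(\boldsymbol w)$. Momentum stochastic gradient recursion: for $i\ge0$, $$\boldsymbol\psi_{i-1}=\boldsymbol w_{i-1}+\beta_1(\boldsymbol w_{i-1}-\boldsymbol w_{i-2}),\qquad \boldsymbol w_i=\boldsymbol\psi_{i-1}-\mu_m\nabla_wQ(\boldsymbol\psi_{i-1};\boldsymbol\theta_i)+\beta_2(\boldsymbol\psi_{i-1}-\boldsymbol\psi_{i-2}),$$ with $\boldsymbol w_{-1}=\boldsymbol w_{-2}-\mu_m\nabla_wQ(\boldsymbol w_{-2};\boldsymbol\theta_{-1})$. Both recursions use the same samples $\boldsymbol\theta_i$. $\mathcal F_{i-1}$ is the $\sigma$-algebra generated by the iterates of the recursions up to time $i-1$ (including the initial states). $\widetilde{\boldsymbol w}_i=w^o-\boldsymbol w_i$, $\widetilde{\boldsymbol x}_i=w^o-\boldsymbol x_i$ (so $\|\widetilde{\boldsymbol w}_i-\widetilde{\boldsymbol x}_i\|=\|\boldsymbol w_i-\boldsymbol x_i\|$). The constants $\gamma^2,\sigma_s^2\ge0$ are constants for which $\mathbb E[\|\boldsymbol s_i(\boldsymbol w)\|^2\mid\mathcal F_{i-1}]\le\gamma^2\|w^o-\boldsymbol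 w\|^2+\sigma_s^2$ holds (they exist because of the fourth-order bound). Fourth moments of the initial states are finite. $O(\cdot)$ is uniform: the hidden constant does not depend on $i$ or $\mu$, but may depend on other fixed problem data and the initial state; ''sufficiently small $\mu$'' means all $\mu\in(0,\bar\mu)$ for some $\bar\mu>0$. The noise constants and $\xi_1,\xi_2$ do not depend on $i$ or the step-sizes. *)

(* Defs.v *)
From HB Require Import structures.
From mathcomp Require Import all_boot all_order all_algebra.
From mathcomp Require Import all_classical all_reals all_analysis.
From mathcomp Require Import measurable_realfun.
Set Implicit Arguments.
Unset Strict Implicit.
Unset Printing Implicit Defensive.
Import Order.TTheory GRing.Theory Num.Theory.
Import numFieldNormedType.Exports.
Local Open Scope classical_set_scope.
Local Open Scope ring_scope.

(* R^M is the space of row vectors 'rV[R]_M.  The norm that the library puts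
   on it is the sup norm; it serves only for the (equivalent) topology and
   differentiability.  All quantitative statements use [enorm]. *)

Definition enorm (R : realType) (M : nat) (v : 'rV[R]_M) : R :=
  Num.sqrt (\sum_(k < M) v 0 k ^+ 2).

Definition opnorm (R : realType) (M : nat) (A : 'M[R]_M) : R :=
  sup [set enorm (v *m A) | v in [set v : 'rV[R]_M | enorm v <= 1]].

Definition loewner_le (R : realType) (M : nat) (A B : 'M[R]_M) : Prop :=
  (B - A)^T = B - A /\ forall v : 'rV[R]_M, 0 <= (v *m (B - A) *m v^T) 0 0.

Definition grad (R : realType) (M : nat) (f : 'rV[R]_M -> R) (w : 'rV[R]_M) :
    'rV[R]_M :=
  \row_(k < M) 'D_(delta_mx 0 k) f w.

Definition hess (R : realType) (M : nat) (f : 'rV[R]_M -> R) (w : 'rV[R]_M) :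
    'M[R]_M :=
  jacobian (grad f) w.

Definition twice_differentiable (R : realType) (M : nat)
    (f : 'rV[R]_M -> R) : Prop :=
  forall w, differentiable f w /\ differentiable (grad f) w.

(* A sub-sigma-algebra is given by a class G of generating events, as <<s G>>.
   A random vector is measurable when its coordinates are. *)
Definition vec_measurable (d : measure_display) (T : measurableType d)
    (R : realType) (M : nat) (v : T -> 'rV[R]_M) : Prop :=
  forall k : 'I_M, measurable_fun [set: T] (fun t => v t 0 k).

(* Joint measurability, R^M carrying its product (= Borel) sigma-algebra,
   which the library provides on tuples. *)
Definition jointly_measurable (d : measure_display) (T : measurableType d)
    (R : realType) (M : nat) (Q : 'rV[R]_M -> T -> R) : Prop :=
  measurable_fun [set: M.-tuple R * T]
    (fun p => Q (\row_(k < M) tnth p.1 k) p.2).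

Section condexp.
Context {d : measure_display} {T : measurableType d} {R : realType}.
Context (P : probability T R) (G : set (set T)).
Local Open Scope ereal_scope.

(* Z is a version of E[X | <<s G>>] for a nonnegative X, which need not be
   integrable. *)
Definition is_condexp_ge0 (X Z : T -> \bar R) : Prop :=
  [/\ measurable_fun [set: T] X, forall t, 0 <= X t,
      measurable_fun [set: g_sigma_algebraType G]
        (Z : g_sigma_algebraType G -> \bar R),
      forall t, 0 <= Z t
    & forall A, <<s G >> A -> \int[P]_(t in A) Z t = \int[P]_(t in A) X t].

(* Z is a version of the generalized conditional expectation
   E[X^+ | <<s G>>] - E[X^- | <<s G>>], which exists as soon as one of the two
   terms is almost surely finite: X itself need not be integrable. *)
Definition is_condexp (X Z : T -> \bar R) : Prop :=
  measurable_fun [set: g_sigma_algebraType G]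
    (Z : g_sigma_algebraType G -> \bar R) /\
  exists Zp Zn : T -> \bar R,
    [/\ is_condexp_ge0 X^\+ Zp, is_condexp_ge0 X^\- Zn,
        {ae P, forall t, mine (Zp t) (Zn t) < +oo}
      & {ae P, forall t, Z t = Zp t - Zn t}].

Definition condexp_eq0 (X : T -> R) : Prop := is_condexp (EFin \o X) (cst 0).

(* E[X | <<s G>>] <= Y almost surely, for X >= 0. *)
Definition condexp_le (X Y : T -> R) : Prop :=
  exists2 Z, is_condexp_ge0 (EFin \o X) Z & {ae P, forall t, Z t <= (Y t)%:E}.

End condexp.

Section recursions.
Context {R : realType} {M : nat} {Omega Theta : Type}.
(* g w t is the gradient at w of the loss for the datum t; the time index of a
   process is an integer, as the recursions start at times -1 and -2. *)
Context (g : 'rV[R]_M -> Theta -> 'rV[R]_M) (theta : int -> Omega -> Theta).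

Definition sgd (mu : R) (init : Omega -> 'rV[R]_M)
    (x : int -> Omega -> 'rV[R]_M) : Prop :=
  x (-1) = init /\
  forall i : int, 0 <= i -> forall o,
    x i o = x (i - 1) o - mu *: g (x (i - 1) o) (theta i o).

Definition momentum_sgd (mum beta1 beta2 : R) (init : Omega -> 'rV[R]_M)
    (w psi : int -> Omega -> 'rV[R]_M) : Prop :=
  [/\ w (-2) = init, psi (-2) = init,
      forall o, w (-1) o = w (-2) o - mum *: g (w (-2) o) (theta (-1) o),
      forall i : int, 0 <= i -> forall o,
        psi (i - 1) o = w (i - 1) o + beta1 *: (w (i - 1) o - w (i - 2) o)
    & forall i : int, 0 <= i -> forall o,
        w i o = psi (i - 1) o - mum *: g (psi (i - 1) o) (theta i o)
                + beta2 *: (psi (i - 1) o - psi (i - 2) o)].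

End recursions.

(* Events determined by one coordinate of Y at one time in [a, t]. *)
Definition events_of (R : realType) (M : nat) (Omega : Type)
    (Y : int -> Omega -> 'rV[R]_M) (a t : int) : set (set Omega) :=
  [set A | exists (j : int) (k : 'I_M) (B : set R),
     [/\ a <= j <= t, measurable B & A = (fun o => Y j o 0 k) @^-1` B]].

(* Generators of the sigma-algebra F_t of the iterates up to time t >= -2. *)
Definition history (R : realType) (M : nat) (Omega : Type)
    (w psi x : int -> Omega -> 'rV[R]_M) (t : int) : set (set Omega) :=
  events_of w (-2) t `|` events_of psi (-2) t `|` events_of x (-1) t.

Definition risk (d d' : measure_display) (Omega : measurableType d)
    (Theta : measurableType d') (R : realType) (P : probability Omega R)
    (M : nat) (Q : 'rV[R]_M -> Theta -> R) (theta : Omega -> Theta)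
    (w : 'rV[R]_M) : R :=
  fine 'E_P[fun o => Q w (theta o)].

Definition gradient_noise (R : realType) (M : nat) (Omega Theta : Type)
    (Q : 'rV[R]_M -> Theta -> R) (J : 'rV[R]_M -> R)
    (theta : int -> Omega -> Theta) (i : int) (v : Omega -> 'rV[R]_M)
    (o : Omega) : 'rV[R]_M :=
  grad (Q^~ (theta i o)) (v o) - grad J (v o).

(* Main.v *)
Require Import Defs.
From HB Require Import structures.
From mathcomp Require Import all_boot all_order all_algebra.
From mathcomp Require Import all_classical all_reals all_analysis.
From mathcomp Require Import measurable_realfun.
From mathcomp Require Import ring lra zify.
Set Implicit Arguments.
Unset Strict Implicit.
Unset Printing Implicit Defensive.
Import Order.TTheory GRing.Theory Num.Theory.
Import numFieldNormedType.Exports.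
Local Open Scope classical_set_scope.
Local Open Scope ring_scope.

(** The momentum recursion is a stochastic gradient recursion in disguise.
    Because one of [beta1], [beta2] vanishes, the increments
    [D_i = w_i - w_{i-1}] obey, in both the heavy-ball and the Nesterov case,
    [D_i = beta D_{i-1} - mum g_i], where [g_i] is the stochastic gradient at
    [psi_{i-1}].  Hence the averaged iterate
    [y_i = w_i + beta / (1 - beta) D_i] satisfies
    [y_i = y_{i-1} - mu g_i] with exactly the step-size [mu] of the plain
    recursion, while [psi_{i-1} = y_{i-1} - lag D_{i-1}].  So [y] and [x]
    perform the same gradient steps, except that the gradient for [y] is
    evaluated at a point displaced by a multiple of the increment.

    Everything then follows from second moments.  Let [a], [d], [e] be the mean
    squares of [y - wo], [D] and [y - x].  The noise is uncorrelated with the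
    past ([msq_noise]), so that its mean square is simply added, with the factor
    [mu ^ 2], to that of a drift step.  Strong monotonicity and Lipschitz
    continuity of the gradient of [J] ([grad_strongly_monotone],
    [grad_lipschitz]) make the drift contract [y - wo] and [y - x] by the factor
    [1 - mu nu], up to an error [O(mu) d] due to the displacement
    ([drift_step]), and the increments contract by the factor [beta], up to an
    error [O(mu ^ 2) a] ([momentum_step]).  This gives, with [s2 = sigma ^ 2],
      [a' <= (1 - mu nu) a + O(mu) d + mu ^ 2 s2],
      [d' <= (beta + O(mu ^ 2)) d + O(mu ^ 2) a + mu ^ 2 s2],
      [e' <= (1 - mu nu) e + O(mu) d].
    As [d] is of order [mu ^ 2] from the start and [beta] is bounded away from 1,
    these inequalities propagate the bounds [a = O(q + s2)],
    [d = O(mu ^ 2 (q + s2))] and [e = O(mu ^ 2 (q + s2))], with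
    [q = rho1 ^ (i + 1)] ([coupled_recursion]).  In the equation for [e] the
    noises of the two recursions enter through their difference only, and this
    is controlled by the displacement; the term [mu ^ 2 s2] is therefore absent,
    and [e] stays of order [mu ^ 2].

    Since [w_i - x_i = (y_i - x_i) - beta / (1 - beta) D_i], the mean square of
    [w_i - x_i] is [O(mu ^ 2 (rho1 ^ (i + 1) + sigma ^ 2))], and both terms are
    dominated by the bracket of the claimed bound, whose hidden constant may
    depend on all data except [i] and [mu]. *)

(** * Euclidean geometry of one step *)

Section inner_product.
Context {R : realType} {M : nat}.
Implicit Types u v w : 'rV[R]_M.

Definition dot u v : R := (u *m v^T) 0 0.
Definition nsq v : R := enorm v ^+ 2.

Lemma dotE u v : dot u v = \sum_k u 0 k * v 0 k.
Proof. by rewrite /dot mxE; apply: eq_bigr => k _; rewrite mxE. Qed.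

Lemma dotC u v : dot u v = dot v u.
Proof. by rewrite !dotE; apply: eq_bigr => k _; rewrite mulrC. Qed.

Lemma dotDl u v w : dot (u + v) w = dot u w + dot v w.
Proof. by rewrite /dot mulmxDl mxE. Qed.

Lemma dotZl a u w : dot (a *: u) w = a * dot u w.
Proof. by rewrite /dot -scalemxAl mxE. Qed.

Lemma dotNl u w : dot (- u) w = - dot u w.
Proof. by rewrite -scaleN1r dotZl mulN1r. Qed.

Lemma dotDr u v w : dot w (u + v) = dot w u + dot w v.
Proof. by rewrite dotC dotDl !(dotC w). Qed.

Lemma dotZr a u w : dot w (a *: u) = a * dot w u.
Proof. by rewrite dotC dotZl (dotC w). Qed.

Lemma dotNr u w : dot w (- u) = - dot w u.
Proof. by rewrite dotC dotNl (dotC w). Qed.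

Lemma nsqE v : nsq v = \sum_k v 0 k ^+ 2.
Proof. by rewrite /nsq /enorm sqr_sqrtr// sumr_ge0// => k _; exact: sqr_ge0. Qed.

Lemma nsq_dot v : nsq v = dot v v.
Proof. by rewrite nsqE dotE; apply: eq_bigr => k _; rewrite expr2. Qed.

Lemma nsq_ge0 v : 0 <= nsq v.
Proof. exact: sqr_ge0. Qed.

Lemma coord_le_nsq v k : v 0 k ^+ 2 <= nsq v.
Proof.
rewrite nsqE (bigD1 k)//= lerDl sumr_ge0// => i _; exact: sqr_ge0.
Qed.

Lemma nsqZ a v : nsq (a *: v) = a ^+ 2 * nsq v.
Proof. by rewrite !nsq_dot dotZl dotZr mulrA -expr2. Qed.

Lemma nsqN v : nsq (- v) = nsq v.
Proof. by rewrite -scaleN1r nsqZ sqrrN expr1n mul1r. Qed.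

Lemma nsqB u v : nsq (u - v) = nsq u - 2 * dot u v + nsq v.
Proof. by rewrite !nsq_dot dotDl !dotDr !dotNl !dotNr (dotC v u); ring. Qed.

Lemma nsqB_le u v : nsq (u - v) <= 2 * nsq u + 2 * nsq v.
Proof.
have := nsq_ge0 (u + v); rewrite nsqB !nsq_dot dotDl !dotDr (dotC v u); lra.
Qed.

(** The gradient is taken at [p = u - c Delta] instead of [u].  Half of the
    contraction [2 mu nu] pays for the cross term with [Delta] (Young's
    inequality), for the second-order terms in [mu], including a noise of
    variance [Gam * nsq p], and for replacing [nsq p] by [nsq u]. *)
Lemma drift_step (mu nu delta Gam c : R) u Delta G :
  0 < mu -> 0 < nu -> 0 < delta -> mu * (delta ^+ 2 + Gam) <= nu / 4 ->
  let p := u - c *: Delta in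
  nu * nsq p <= dot G p -> nsq G <= delta ^+ 2 * nsq p ->
  nsq (u - mu *: G) + mu ^+ 2 * (Gam * nsq p) <=
  (1 - mu * nu) * nsq u
  + mu * ((2 * delta ^+ 2 / nu + 5 * nu) * c ^+ 2) * nsq Delta.
Proof.
move=> mu0 nu0 delta0 small p mono lip.
have p0 := nsq_ge0 p.
pose eta := nu / (2 * delta ^+ 2).
have d2 : 0 < delta ^+ 2 by rewrite exprn_gt0.
have eta0 : 0 < eta by rewrite divr_gt0// mulr_gt0.
have uE : u = p + c *: Delta by rewrite subrK.
(* Young's inequality with the weight that turns [eta * nsq G] into at most
   [nu / 2 * nsq p]. *)
have young : - (2 * c * dot Delta G) <=
    nu / 2 * nsq p + 2 * delta ^+ 2 / nu * c ^+ 2 * nsq Delta.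
  have : 0 <= eta * nsq (G + (c / eta) *: Delta).
    by rewrite mulr_ge0 ?nsq_ge0// ltW.
  rewrite -(opprK (_ *: Delta)) nsqB nsqN nsqZ dotNr dotZr (dotC G).
  have -> : eta * (nsq G - 2 * - (c / eta * dot Delta G)
      + (c / eta) ^+ 2 * nsq Delta) =
      eta * nsq G + 2 * c * dot Delta G + c ^+ 2 / eta * nsq Delta.
    by field; rewrite gt_eqF.
  have -> : c ^+ 2 / eta = 2 * delta ^+ 2 / nu * c ^+ 2.
    by rewrite /eta; field; rewrite !gt_eqF.
  have : eta * nsq G <= nu / 2 * nsq p.
    have -> : nu / 2 * nsq p = eta * (delta ^+ 2 * nsq p).
      by rewrite /eta; field; rewrite gt_eqF.
    by rewrite ler_pM2l.
  lra.
have split : nsq u <= 5 / 4 * nsq p + 5 * c ^+ 2 * nsq Delta.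
  have := nsq_ge0 (p - (4 * c) *: Delta).
  rewrite uE -(opprK (c *: Delta)) !nsqB dotNr !dotZr nsqN !nsqZ; lra.
have uG : dot u G = dot G p + c * dot Delta G.
  by rewrite {1}uE dotDl dotZl (dotC p).
rewrite nsqB dotZr nsqZ uG.
have e1 : mu ^+ 2 * nsq G <= mu ^+ 2 * (delta ^+ 2 * nsq p).
  by rewrite ler_pM2l// exprn_gt0.
have e2 : mu * (mu * (delta ^+ 2 + Gam) * nsq p) <= mu * (nu / 4 * nsq p).
  by rewrite ler_pM2l// ler_wpM2r.
have e3 : mu * (nu * nsq p) <= mu * dot G p by rewrite ler_pM2l.
have e4 := ler_wpM2l (ltW mu0) young.
have e5 : mu * nu * nsq u <=
    mu * nu * (5 / 4 * nsq p + 5 * c ^+ 2 * nsq Delta).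
  by rewrite ler_pM2l// mulr_gt0.
lra.
Qed.

Lemma nsq_convex (b : R) u v : 0 <= b <= 1 ->
  nsq (b *: u - (1 - b) *: v) <= b * nsq u + (1 - b) * nsq v.
Proof.
move=> /andP[b0 b1].
have : 0 <= b * (1 - b) * nsq (u + v).
  by apply: mulr_ge0 (nsq_ge0 _); apply: mulr_ge0; lra.
rewrite nsqB dotZl dotZr !nsqZ -(opprK v) nsqB !nsqN !dotNr; lra.
Qed.

(** Writing the step as the convex combination of [Delta] and [- mu G] with
    weight [beta] keeps the contraction factor [beta] for [nsq Delta]. *)
Lemma momentum_step (mu beta delta Gam c : R) u Delta G :
  0 <= beta <= 1 -> 0 <= Gam ->
  let p := u - c *: Delta in
  nsq G <= delta ^+ 2 * nsq p ->
  nsq (beta *: Delta - (mu * (1 - beta)) *: G)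
    + (mu * (1 - beta)) ^+ 2 * (Gam * nsq p) <=
  (beta + mu ^+ 2 * (2 * (delta ^+ 2 + Gam) * c ^+ 2)) * nsq Delta
  + mu ^+ 2 * (2 * (delta ^+ 2 + Gam)) * nsq u.
Proof.
move=> /andP[b0 b1] Gam0 p lip.
have p0 := nsq_ge0 p.
have := @nsq_convex beta Delta (mu *: G); rewrite b0 b1 => /(_ isT).
rewrite scalerA (mulrC (1 - beta)) nsqZ => h.
have hp : nsq p <= 2 * nsq u + 2 * (c ^+ 2 * nsq Delta).
  by rewrite -nsqZ nsqB_le.
have bb2 : (1 - beta) ^+ 2 <= 1 by rewrite expr_le1//; lra.
have m0 : 0 <= mu ^+ 2 by exact: sqr_ge0.
have e1 : (1 - beta) * (mu ^+ 2 * nsq G) <= mu ^+ 2 * (delta ^+ 2 * nsq p).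
  apply: (@le_trans _ _ (mu ^+ 2 * nsq G)); last by rewrite ler_wpM2l.
  by apply: ler_piMl; [apply: mulr_ge0 => //; exact: nsq_ge0 | lra].
have e2 : (mu * (1 - beta)) ^+ 2 * (Gam * nsq p) <= mu ^+ 2 * (Gam * nsq p).
  by rewrite exprMn; apply: ler_wpM2r; [exact: mulr_ge0 | exact: ler_piMr].
have e3 : mu ^+ 2 * (delta ^+ 2 + Gam) * nsq p <=
    mu ^+ 2 * (delta ^+ 2 + Gam) * (2 * nsq u + 2 * (c ^+ 2 * nsq Delta)).
  by apply: ler_wpM2l hp; apply: mulr_ge0 => //; rewrite addr_ge0// sqr_ge0.
lra.
Qed.

End inner_product.

(** * The gradient of a strongly convex function with bounded Hessian *)

Section calculus.
Context {R : realType} {M : nat}.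

Lemma is_derive_line (V : normedModType R) (f : 'rV[R]_M -> V) (a v : 'rV[R]_M)
    (t : R) : differentiable f (a + t *: v) ->
  is_derive t (1 : R) (fun s : R => f (a + s *: v)) ('D_v f (a + t *: v)).
Proof.
move=> df; have dfv := diff_derivable (v := v) df.
have E : (fun h : R => h^-1 *: (((fun s : R => f (a + s *: v)) \o shift t)
    (h *: (1 : R)) - f (a + t *: v))) =
  (fun h => h^-1 *: ((f \o shift (a + t *: v)) (h *: v) - f (a + t *: v))).
  apply/funext => h /=; rewrite /shift /=; congr (_ *: (f _ - _)).
  by rewrite -[h *: 1]/(h * 1) mulr1 scalerDl addrCA.
by apply: DeriveDef; [rewrite /derivable E | rewrite /derive E].
Qed.

Lemma dot_continuous (h : 'rV[R]_M) : continuous (fun v : 'rV[R]_M => dot v h).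
Proof.
have -> : (fun v : 'rV[R]_M => dot v h) = (fun v => \sum_k v 0 k * h 0 k).
  by apply/funext => v; rewrite dotE.
apply: continuous_big; first exact: add_continuous.
move=> k _ v; apply: (@cvgM _ _ (nbhs v)); [exact: coord_continuous | exact: cvg_cst].
Qed.

Lemma is_derive_dot_line (f : 'rV[R]_M -> 'rV[R]_M) (a v h : 'rV[R]_M) (t : R) :
  differentiable f (a + t *: v) ->
  is_derive t (1 : R) (fun s : R => dot (f (a + s *: v)) h)
    (dot (v *m jacobian f (a + t *: v)) h).
Proof.
move=> df; have [dl Dl] := is_derive_line df.
rewrite -deriveEjacobian//.
set F := fun s : R => f (a + s *: v) in dl Dl.
pose q := fun r : R => r^-1 *: ((F \o shift t) (r *: (1 : R)) - F t).
have qE : (fun r : R => r^-1 *: (((fun s => dot (F s) h) \o shift t)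
    (r *: (1 : R)) - dot (F t) h)) = (fun w => dot w h) \o q.
  by apply/funext => r; rewrite /= dotZl dotDl dotNl.
have cv : ((fun w => dot w h) \o q) r @[r --> 0^'] -->
    dot ('D_v f (a + t *: v)) h.
  by rewrite -Dl; apply: (continuous_cvg _ (@dot_continuous h _) dl).
apply: DeriveDef; first by rewrite /derivable qE; apply/cvg_ex; eexists; exact: cv.
by rewrite /derive qE; exact: cvg_lim cv.
Qed.

(** A vector-valued mean value theorem fails, so the increment of [f] is tested
    against a fixed direction [h]; the intermediate point depends on [h]. *)
Lemma gradient_mean_value (f : 'rV[R]_M -> 'rV[R]_M) (a b h : 'rV[R]_M) :
  (forall w, differentiable f w) ->
  exists w, dot (f a - f b) h = dot ((a - b) *m jacobian f w) h.
Proof.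
move=> df; pose v := a - b.
have D t := @is_derive_dot_line f b v h t (df _).
pose phi := fun s : R => dot (f (b + s *: v)) h.
have cphi : {within `[0, 1], continuous phi}.
  by apply: derivable_within_continuous => t _; have [] := D t.
have [t _] := MVT ltr01 (fun t _ => D t) cphi.
rewrite /phi scale1r scale0r addr0 subr0 mulr1 [b + v]addrC subrK => E.
by exists (b + t *: v); rewrite dotDl dotNl.
Qed.

End calculus.

Section risk_gradient.
Context {R : realType} {M : nat}.
Variables (J : 'rV[R]_M -> R) (nu delta : R).
Hypothesis J2 : twice_differentiable J.
Hypothesis Jhess : forall w, loewner_le nu%:M (hess J w) /\
  loewner_le (hess J w) delta%:M.

Lemma hess_sym w : (hess J w)^T = hess J w.
Proof.
have [[+ _] _] := Jhess w; rewrite linearB /= tr_scalar_mx => /addIr; exact.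
Qed.

Lemma hess_ge w v : nu * nsq v <= dot (v *m hess J w) v.
Proof.
have [[_ /(_ v) + ] _] := Jhess w.
rewrite mulmxBr mulmxBl mxE [X in _ + X]mxE mul_mx_scalar -/(dot _ _).
by rewrite -[X in _ - X]/(dot (nu *: v) v) dotZl nsq_dot subr_ge0.
Qed.

Lemma hess_le w v : dot (v *m hess J w) v <= delta * nsq v.
Proof.
have [_ [_ /(_ v) +]] := Jhess w.
rewrite mulmxBr mulmxBl mxE [X in _ + X]mxE mul_mx_scalar -/(dot _ _).
by rewrite -[X in _ - X]/(dot (v *m hess J w) v) dotZl nsq_dot subr_ge0.
Qed.

Lemma hess_dotC w u v : dot (u *m hess J w) v = dot (v *m hess J w) u.
Proof.
rewrite /dot; have -> : v *m hess J w *m u^T = (u *m hess J w *m v^T)^T.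
  by rewrite !trmx_mul trmxK hess_sym mulmxA.
by rewrite [RHS]mxE.
Qed.

Lemma grad_strongly_monotone a b :
  nu * nsq (a - b) <= dot (grad J a - grad J b) (a - b).
Proof.
have [|w ->] := @gradient_mean_value _ _ (grad J) a b (a - b).
  by move=> w; have [] := J2 w.
exact: hess_ge.
Qed.

Hypotheses (nu0 : 0 < nu) (delta0 : 0 < delta).

(** The mean value theorem is used in the direction [G] of the gradient
    increment itself.  Nonnegativity of the Hessian form at [delta v - G] then
    bounds [G H v] by [v H v] and [G H G], which replaces the
    Cauchy-Schwarz inequality and the spectral theorem. *)
Lemma grad_lipschitz a b :
  nsq (grad J a - grad J b) <= delta ^+ 2 * nsq (a - b).
Proof.
set G := grad J a - grad J b; set v := a - b.
have [|w] := @gradient_mean_value _ _ (grad J) a b G.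
  by move=> w; have [] := J2 w.
rewrite -/G -/v -nsq_dot => E; clearbody G v.
have psd : 0 <= dot ((delta *: v - G) *m hess J w) (delta *: v - G).
  by apply: le_trans (hess_ge w _); rewrite mulr_ge0 ?nsq_ge0// ltW.
have := hess_le w G; have := hess_le w (delta *: v); move: psd.
rewrite mulmxBl -scalemxAl !dotDl !dotDr !dotNl !dotNr !dotZl !dotZr.
rewrite (hess_dotC w G v) -E nsqZ => psd hv hG.
have : delta * nsq G <= delta * (delta ^+ 2 * nsq v) by lra.
by rewrite ler_pM2l.
Qed.

Lemma grad_min0 wo : (forall w, J wo <= J w) -> grad J wo = 0.
Proof.
move=> min; apply/rowP => k; rewrite mxE [RHS]mxE.
set e : 'rV[R]_M := delta_mx 0 k.
have D t : is_derive t (1 : R) (fun s : R => J (wo + s *: e)) _ :=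
  is_derive_line (V := R) (proj1 (J2 (wo + t *: e))).
have : is_derive (0 : R) (1 : R) (fun s : R => J (wo + s *: e)) 0.
  apply: (@derive1_at_min _ _ (-1) 1); first by lra.
  - by move=> t _; exact: ex_derive.
  - by rewrite in_itv /=; apply/andP; split; lra.
  - by move=> t _; rewrite scale0r addr0.
move=> /@derive_val; have := D 0; rewrite scale0r addr0 => /@derive_val -> //.
Qed.

End risk_gradient.

(** * Measurability of random vectors *)

Section vector_measurability.
Context {d : measure_display} {T : measurableType d} {R : realType} {M : nat}.
Implicit Types u v : T -> 'rV[R]_M.

(** [v] is rounded down to the grid of mesh [1 / n.+1].  A function of the
    rounded vector takes countably many values, and converges to [f \o v] as
    the mesh decreases. *)
Lemma continuous_vec_measurable (f : 'rV[R]_M -> R) v :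
  continuous f -> vec_measurable v -> measurable_fun [set: T] (f \o v).
Proof.
move=> cf mv.
pose key (n : nat) t : 'rV[int]_M := \row_k Num.floor (n.+1%:R * v t 0 k).
pose pt (n : nat) (z : 'rV[int]_M) : 'rV[R]_M :=
  \row_k ((z 0 k)%:~R / n.+1%:R).
have n0 (n : nat) : (0 : R) < n.+1%:R by rewrite ltr0n.
apply: (@measurable_fun_cvg _ _ _ _ (fun n t => f (pt n (key n t)))).
- move=> n _ B mB; rewrite setTI.
  have -> : (fun t => f (pt n (key n t))) @^-1` B =
     \bigcup_(z in [set: 'rV[int]_M]) [set t | B (f (pt n z)) /\ key n t = z].
    apply/seteqP; split=> t /=; first by move=> Bt; exists (key n t).
    by move=> [z _ [Bz ->]].
  apply: countable_bigcupT_measurable => // z.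
  have [Bz|nBz] := pselect (B (f (pt n z))); last first.
    rewrite (_ : mkset _ = set0)//; apply/seteqP; split=> // t [] //.
  have -> : [set t | B (f (pt n z)) /\ key n t = z] =
     \bigcap_(k in [set: 'I_M]) (fun t => v t 0 k) @^-1`
       `[(z 0 k)%:~R / n.+1%:R, (z 0 k + 1)%:~R / n.+1%:R[%classic.
    apply/seteqP; split=> t /=.
      move=> [_ <-] k _ /=; rewrite in_itv /= mxE.
      by rewrite ler_pdivrMr// ltr_pdivlMr// mulrC; exact: floor_itv.
    move=> h; split=> //; apply/rowP => k; rewrite mxE; apply: floor_def.
    have := h k I; rewrite /= in_itv /= ler_pdivrMr// ltr_pdivlMr//.
    by rewrite mulrC.
  apply: fin_bigcap_measurable => // k _; rewrite -[X in measurable X]setTI.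
  by apply: mv => //; exact: measurable_itv.
- move=> t _; apply: continuous_cvg; first exact: cf.
  move=> /= A [B Bv BA].
  have cvk (k : 'I_M) : pt n (key n t) 0 k @[n --> \oo] --> v t 0 k.
    apply: (@squeeze_cvgr _ _ _ _ (fun n => v t 0 k - harmonic n)
      (fun=> v t 0 k)).
    + near=> n; rewrite mxE mxE /harmonic.
      have /andP[l u] := floor_itv (n.+1%:R * v t 0 k : R).
      apply/andP; split.
        rewrite ler_pdivlMr// mulrBl mulVf ?gt_eqF// mulrC lerBlDr.
        by move: u; rewrite intrD => /ltW.
      by rewrite ler_pdivrMr// [leRHS]mulrC.
    + rewrite -[X in _ --> X]subr0; apply: cvgB; first exact: cvg_cst.
      exact: cvg_harmonic.
    + exact: cvg_cst.
  have : \forall n \near \oo, forall k, B 0 k (pt n (key n t) 0 k).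
    by apply: filter_forall => k; exact: cvk (Bv 0 k).
  by apply: filterS => n h; apply: BA => i j; rewrite ord1.
Unshelve. all: by end_near. Qed.

Lemma vec_measurableD u v : vec_measurable u -> vec_measurable v ->
  vec_measurable (fun t => u t + v t).
Proof.
move=> mu mv k; under eq_fun do rewrite mxE.
exact: measurable_funD (mu k) (mv k).
Qed.

Lemma vec_measurableZ a v : vec_measurable v ->
  vec_measurable (fun t => a *: v t).
Proof.
move=> mv k; under eq_fun do rewrite mxE.
exact: measurable_funM (measurable_cst _) (mv k).
Qed.

Lemma vec_measurableN v : vec_measurable v -> vec_measurable (fun t => - v t).
Proof.
move=> mv k; under eq_fun do rewrite mxE.
exact: measurableT_comp (mv k).
Qed.

Lemma vec_measurableB u v : vec_measurable u -> vec_measurable v ->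
  vec_measurable (fun t => u t - v t).
Proof. by move=> mu mv; apply: vec_measurableD => //; exact: vec_measurableN. Qed.

Lemma vec_measurable_cst (a : 'rV[R]_M) : vec_measurable (fun _ : T => a).
Proof. by move=> k; exact: measurable_cst. Qed.

Lemma measurable_dot u v : vec_measurable u -> vec_measurable v ->
  measurable_fun [set: T] (fun t => dot (u t) (v t)).
Proof.
move=> mu mv; under eq_fun do rewrite dotE.
apply: measurable_sum => k; exact: measurable_funM (mu k) (mv k).
Qed.

Lemma measurable_nsq v : vec_measurable v ->
  measurable_fun [set: T] (fun t => nsq (v t)).
Proof. by move=> mv; under eq_fun do rewrite nsq_dot; exact: measurable_dot. Qed.

Lemma continuous_map_vec_measurable (f : 'rV[R]_M -> 'rV[R]_M) v :
  continuous f -> vec_measurable v -> vec_measurable (f \o v).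
Proof.
move=> cf mv k; apply: (@continuous_vec_measurable (fun w => f w 0 k)) => // w.
by apply: (@continuous_comp _ _ _ f (fun u : 'rV[R]_M => u 0 k));
  [exact: cf | exact: coord_continuous].
Qed.

End vector_measurability.

(** * Conditional expectation *)

Lemma integrable_EFinD d (T : measurableType d) (R : realType)
    (mu : measure T R) (f g : T -> R) :
  mu.-integrable [set: T] (EFin \o f) -> mu.-integrable [set: T] (EFin \o g) ->
  mu.-integrable [set: T] (EFin \o (fun t => f t + g t)).
Proof. by move=> fi gi; exact: (integrableD _ fi gi). Qed.

Section conditional_expectation.
Context {d : measure_display} {T : measurableType d} {R : realType}.
Variables (P : probability T R) (G : set (set T)).
Hypothesis hG : <<s G >> `<=` (@measurable _ T).

Lemma sub_sigma_measurable_fun d' (U : measurableType d') (f : T -> U) :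
  measurable_fun [set: g_sigma_algebraType G] (f : g_sigma_algebraType G -> U) ->
  measurable_fun [set: T] f.
Proof. by move=> mf _ B mB; apply: hG; exact: mf. Qed.

Lemma sub_sigma_vec_measurable M (v : T -> 'rV[R]_M) :
  vec_measurable (v : g_sigma_algebraType G -> 'rV[R]_M) -> vec_measurable v.
Proof. by move=> mv k; apply: sub_sigma_measurable_fun; exact: mv. Qed.

Import HBNNSimple.

Lemma ge0_integral_nnsfunM (U : {nnsfun (g_sigma_algebraType G) >-> R})
    (f : T -> R) : measurable_fun [set: T] f -> (forall t, 0 <= f t) ->
  (\int[P]_t (U t * f t)%:E =
   \sum_(y \in range U) y%:E * \int[P]_(t in U @^-1` [set y]) (f t)%:E)%E.
Proof.
move=> mf f0.
have mU y : @measurable _ T (U @^-1` [set y]).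
  by apply: hG; exact: (@measurable_funPTI _ _ _ _ U [set y]).
have m1 y : measurable_fun [set: T] (\1_(U @^-1` [set y]) : T -> R).
  exact: measurable_indic.
have mterm y : measurable_fun [set: T]
    (fun t => (y * \1_(U @^-1` [set y]) t * f t)%:E).
  apply/measurable_EFinP; apply: measurable_funM => //.
  exact: measurable_funM.
have ge0 y t : (0 <= (y * \1_(U @^-1` [set y]) t * f t)%:E)%E.
  rewrite lee_fin mulr_ge0//.
  have := @nnfun_muleindic_ge0 _ _ _ U y t.
  by rewrite -EFinM lee_fin.
transitivity (\sum_(y \in range U)
    \int[P]_t (y * \1_(U @^-1` [set y]) t * f t)%:E)%E.
  rewrite -ge0_integral_fsum//.
  apply: eq_integral => t _.
  rewrite fimfunE !(fsbig_finite _ _ (fimfunP U))/= mulr_suml -sumEFin.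
  by [].
apply: eq_fsbigr => y /set_mem [z _ <-].
rewrite [in RHS]integral_mkcond -ge0_integralZl//.
- apply: eq_integral => t _; rewrite patchE indicE.
  by case: (t \in _); rewrite ?mulr1 ?mulr0 ?mul0r ?mule0// EFinM.
- apply/(measurable_restrictT _ _).1 => //.
  by apply: measurable_funTS; exact/measurable_EFinP.
- by move=> t _; rewrite patchE; case: ifP; rewrite ?lee_fin.
- by rewrite lee_fin; have := @fun_ge0 _ _ U z.
Qed.

(** Two densities with the same integral over every event of a
    sub-sigma-algebra have the same integral against every nonnegative function
    measurable for it: approximate this function by simple functions.  This
    is how factors known from the past are pulled out of conditional
    expectations. *)
Lemma ge0_integralM_sub_sigma (U f g : T -> R) :
  measurable_fun [set: g_sigma_algebraType G] (U : g_sigma_algebraType G -> R) ->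
  (forall t, 0 <= U t) ->
  measurable_fun [set: T] f -> (forall t, 0 <= f t) ->
  measurable_fun [set: T] g -> (forall t, 0 <= g t) ->
  (forall A, <<s G >> A ->
    \int[P]_(t in A) (f t)%:E = \int[P]_(t in A) (g t)%:E)%E ->
  (\int[P]_t (U t * f t)%:E = \int[P]_t (U t * g t)%:E)%E.
Proof.
move=> mU U0 mf f0 mg g0 fg.
have mEU : measurable_fun [set: g_sigma_algebraType G]
  (EFin \o U : g_sigma_algebraType G -> \bar R) by exact/measurable_EFinP.
have EU0 (t : g_sigma_algebraType G) : [set: g_sigma_algebraType G] t ->
  (0 <= (EFin \o U) t)%E by rewrite lee_fin.
pose V n : T -> R := nnsfun_approx measurableT mEU n.
have cvV (h : T -> R) : measurable_fun [set: T] h -> (forall t, 0 <= h t) ->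
    (\int[P]_t (V n t * h t)%:E @[n --> \oo] --> \int[P]_t (U t * h t)%:E)%E.
  move=> mh h0.
  have mV n : measurable_fun [set: T] (V n).
    by apply: sub_sigma_measurable_fun; exact: measurable_funPT.
  have := @cvg_monotone_convergence _ _ _ P _ measurableT
    (fun n t => (V n t * h t)%:E).
  have -> : (fun t : T => limn ((fun n t0 => (V n t0 * h t0)%:E)^~ t)) =
      (fun t => (U t * h t)%:E).
    apply/funext => t; apply: cvg_lim => //; apply: cvg_EFin.
      by apply: nearW.
    apply: cvgM; last exact: cvg_cst.
    have /fine_cvgP[_] := cvg_nnsfun_approx measurableT mEU EU0 (x := t) I.
    exact.
  apply.
  - by move=> n; apply/measurable_EFinP; exact: measurable_funM.
  - by move=> n t _; rewrite lee_fin mulr_ge0//.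
  - move=> t _ m n mn; rewrite lee_fin ler_wpM2r//.
    by have /lefP := nd_nnsfun_approx measurableT mEU mn; exact.
have VE : (fun n => \int[P]_t (V n t * f t)%:E)%E =
    (fun n => \int[P]_t (V n t * g t)%:E)%E.
  apply/funext => n; rewrite /V !ge0_integral_nnsfunM//.
  apply: eq_fsbigr => y _; rewrite fg//.
  exact: (@measurable_funPTI _ _ _ _ (nnsfun_approx measurableT mEU n) [set y]).
have := cvV f mf f0; rewrite VE => cf.
exact: (cvg_unique _ cf (cvV g mg g0)).
Qed.

Lemma condexp_eq0_measurable (X : T -> R) :
  condexp_eq0 P G X -> measurable_fun [set: T] X.
Proof.
move=> [_ [Zp [Zn [[mp _ _ _ _] [mn _ _ _ _] _ _]]]].
apply/measurable_EFinP; rewrite [EFin \o X]funeposneg.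
exact: emeasurable_funB.
Qed.

(** A vanishing difference of two extended reals forces both to be equal and
    finite, hence the conditional expectations of the positive and negative
    parts agree almost surely. *)
Lemma condexp_eq0_integral (X : T -> R) A : condexp_eq0 P G X -> <<s G >> A ->
  (\int[P]_(t in A) (Num.max (X t) 0)%:E =
   \int[P]_(t in A) (Num.max (- X t) 0)%:E)%E.
Proof.
move=> [_ [Zp [Zn [[_ _ mZp Zp0 ip] [_ _ mZn Zn0 in_] fin ZE]]]] GA.
transitivity (\int[P]_(t in A) Zp t)%E.
  by rewrite ip//; apply: eq_integral => t _; rewrite funeposE /= EFin_max.
transitivity (\int[P]_(t in A) Zn t)%E; last first.
  by rewrite in_//; apply: eq_integral => t _; rewrite funenegE /= EFin_max.
have mA : measurable A by exact: hG.
apply: ge0_ae_eq_integral => //.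
- apply: measurable_funTS; exact: sub_sigma_measurable_fun.
- apply: measurable_funTS; exact: sub_sigma_measurable_fun.
- move: fin ZE; apply: filterS2 => t /= fin ZE _.
  move: fin ZE (Zp0 t) (Zn0 t); case: (Zp t) => [a| |]; case: (Zn t) => [b| |]//=.
  move=> _ /eqP; rewrite -EFinB eqe eq_sym subr_eq0 => /eqP -> //.
Qed.

(** The positive and negative parts of [X] have the same integral against both
    parts of [U]; integrability of [U * X] makes the four products
    integrable. *)
Lemma condexp_eq0_orthogonal (U X : T -> R) :
  measurable_fun [set: g_sigma_algebraType G] (U : g_sigma_algebraType G -> R) ->
  condexp_eq0 P G X -> P.-integrable [set: T] (fun t => (U t * X t)%:E) ->
  (\int[P]_t (U t * X t) = 0)%R.
Proof.
move=> mU cX iUX.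
pose pos (f : T -> R) t := Num.max (f t) 0.
pose neg (f : T -> R) t := Num.max (- f t) 0.
have pos0 f t : 0 <= pos f t by rewrite /pos le_max lexx orbT.
have neg0 f t : 0 <= neg f t by rewrite /neg le_max lexx orbT.
have posneg f t : f t = pos f t - neg f t.
  by rewrite /pos /neg; case: (leP (f t) 0); case: (leP (- f t) 0); lra.
have pos_le f t : pos f t <= `|f t|.
  by rewrite /pos ge_max normr_ge0 ler_norm.
have neg_le f t : neg f t <= `|f t|.
  by rewrite /neg ge_max normr_ge0 -normrN ler_norm.
have mX := condexp_eq0_measurable cX.
have mp d' (T' : measurableType d') (f : T' -> R) : measurable_fun [set: T'] f ->
    measurable_fun [set: T'] (fun t => Num.max (f t) 0).
  by move=> mf; exact: measurable_maxr.
have mn d' (T' : measurableType d') (f : T' -> R) : measurable_fun [set: T'] f ->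
    measurable_fun [set: T'] (fun t => Num.max (- f t) 0).
  move=> mf; apply: measurable_maxr => //; exact: measurableT_comp.
have mUT := sub_sigma_measurable_fun mU.
have dom (f g : T -> R) : measurable_fun [set: T] f -> measurable_fun [set: T] g ->
    (forall t, 0 <= f t <= `|U t|) -> (forall t, 0 <= g t <= `|X t|) ->
    P.-integrable [set: T] (EFin \o (fun t => f t * g t)).
  move=> mf mg fU gX; apply: le_integrable iUX => //.
    by apply/measurable_EFinP; exact: measurable_funM.
  move=> t _; rewrite /= lee_fin !normrM.
  have /andP[f0 fle] := fU t; have /andP[g0 gle] := gX t.
  by rewrite !(ger0_norm f0) (ger0_norm g0) ler_pM.
have swap (V : T -> R) : measurable_fun [set: g_sigma_algebraType G]
    (V : g_sigma_algebraType G -> R) -> (forall t, 0 <= V t) ->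
    \int[P]_t (V t * pos X t) = \int[P]_t (V t * neg X t).
  move=> mV V0; congr fine; apply: ge0_integralM_sub_sigma => //.
  - exact: mp.
  - exact: mn.
  - by move=> A GA; exact: condexp_eq0_integral.
have UX t : U t * X t = (pos U t * pos X t + neg U t * neg X t)
    - (pos U t * neg X t + neg U t * pos X t).
  by rewrite (posneg U) (posneg X); ring.
have P1 := dom (pos U) (pos X) (mp _ _ _ mUT) (mp _ _ _ mX).
have P2 := dom (neg U) (neg X) (mn _ _ _ mUT) (mn _ _ _ mX).
have P3 := dom (pos U) (neg X) (mp _ _ _ mUT) (mn _ _ _ mX).
have P4 := dom (neg U) (pos X) (mn _ _ _ mUT) (mp _ _ _ mX).
have {}P1 : P.-integrable [set: T] (EFin \o (fun t => pos U t * pos X t)).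
  by apply: P1 => t; apply/andP.
have {}P2 : P.-integrable [set: T] (EFin \o (fun t => neg U t * neg X t)).
  by apply: P2 => t; apply/andP.
have {}P3 : P.-integrable [set: T] (EFin \o (fun t => pos U t * neg X t)).
  by apply: P3 => t; apply/andP.
have {}P4 : P.-integrable [set: T] (EFin \o (fun t => neg U t * pos X t)).
  by apply: P4 => t; apply/andP.
under eq_Rintegral do rewrite UX.
rewrite RintegralB// ?RintegralD//; try exact: integrable_EFinD.
rewrite -(swap (pos U))//; last exact: mp.
rewrite -(swap (neg U))//; last exact: mn.
by rewrite subrr.
Qed.

Lemma condexp_le_mono (X Y Y' : T -> R) : (forall t, Y t <= Y' t) ->
  condexp_le P G X Y -> condexp_le P G X Y'.
Proof.
move=> YY' [Z cZ ZY]; exists Z => //; move: ZY; apply: filterS => t /= ZY.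
by rewrite (le_trans ZY)// lee_fin.
Qed.

Lemma condexp_le_integral (X Y : T -> R) :
  condexp_le P G X Y -> measurable_fun [set: T] Y -> (forall t, 0 <= Y t) ->
  [/\ measurable_fun [set: T] X, forall t, 0 <= X t &
     (\int[P]_t (X t)%:E <= \int[P]_t (Y t)%:E)%E].
Proof.
move=> [Z [mX X0 mZ Z0 iZ] ZY] mY Y0; split => //.
- exact/measurable_EFinP.
- rewrite -(iZ setT); last exact: (@measurableT _ (g_sigma_algebraType G)).
  apply: ae_ge0_le_integral => //.
  + exact: sub_sigma_measurable_fun.
  + by move=> t _; rewrite lee_fin.
  + exact/measurable_EFinP.
  + by move: ZY; apply: filterS => t.
Qed.

End conditional_expectation.

(** * Square-integrable random vectors *)

Section square_integrable_vectors.
Context {d : measure_display} {T : measurableType d} {R : realType} {M : nat}.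
Variable P : probability T R.
Implicit Types u v : T -> 'rV[R]_M.

Definition L2 v := vec_measurable v /\
  P.-integrable [set: T] (EFin \o (fun t => nsq (v t))).

Definition msq v : R := \int[P]_t nsq (v t).

Lemma msq_ge0 v : 0 <= msq v.
Proof. by apply: Rintegral_ge0 => t _; exact: nsq_ge0. Qed.

Lemma integrable_EFinZ a (f : T -> R) : P.-integrable [set: T] (EFin \o f) ->
  P.-integrable [set: T] (EFin \o (fun t => a * f t)).
Proof. by move=> fi; exact: (integrableZl measurableT a fi). Qed.

Lemma le_integrable_EFin (f g : T -> R) : measurable_fun [set: T] f ->
  (forall t, `|f t| <= g t) -> P.-integrable [set: T] (EFin \o g) ->
  P.-integrable [set: T] (EFin \o f).
Proof.
move=> mf fg gi; apply: le_integrable gi => //; first exact/measurable_EFinP.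
by move=> t _; rewrite /= lee_fin (le_trans (fg t))// ler_norm.
Qed.

Lemma integrable_EFin_cst (a : R) : P.-integrable [set: T] (EFin \o cst a).
Proof.
exact: finite_measure_integrable_cst.
Qed.

Lemma L2D u v : L2 u -> L2 v -> L2 (fun t => u t + v t).
Proof.
move=> [mu iu] [mv iv]; have m := vec_measurableD mu mv; split=> //.
apply: (@le_integrable_EFin _ (fun t => 2 * nsq (u t) + 2 * nsq (v t))).
- exact: measurable_nsq.
- move=> t; rewrite ger0_norm ?nsq_ge0// -(nsqN (v t)) -{1}(opprK (v t)).
  exact: nsqB_le.
- by apply: integrable_EFinD; exact: integrable_EFinZ.
Qed.

Lemma L2Z a v : L2 v -> L2 (fun t => a *: v t).
Proof.
move=> [mv iv]; split; first exact: vec_measurableZ.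
rewrite (_ : _ \o _ = EFin \o (fun t => a ^+ 2 * nsq (v t))).
  exact: integrable_EFinZ.
by apply/funext => t; rewrite /= nsqZ.
Qed.

Lemma L2N v : L2 v -> L2 (fun t => - v t).
Proof.
by move=> /(L2Z (-1)); under eq_fun do rewrite scaleN1r.
Qed.

Lemma L2B u v : L2 u -> L2 v -> L2 (fun t => u t - v t).
Proof. by move=> Lu Lv; apply: L2D => //; exact: L2N. Qed.

Lemma L2_cst (a : 'rV[R]_M) : L2 (fun=> a).
Proof. by split; [exact: vec_measurable_cst | exact: integrable_EFin_cst]. Qed.

Lemma L2_dominated a u v : vec_measurable v -> L2 u ->
  (forall t, nsq (v t) <= a * nsq (u t)) -> L2 v.
Proof.
move=> mv [mu iu] vu; split => //.
apply: (@le_integrable_EFin _ (fun t => a * nsq (u t))).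
- exact: measurable_nsq.
- by move=> t; rewrite ger0_norm ?nsq_ge0.
- exact: integrable_EFinZ.
Qed.

Lemma norm_coordM_le (x y : 'rV[R]_M) k :
  `|x 0 k * y 0 k| <= nsq x + nsq y.
Proof.
have := coord_le_nsq x k; have := coord_le_nsq y k.
set a := x 0 k; set b := y 0 k => hb ha.
have := sqr_ge0 (a - b); have := sqr_ge0 (a + b).
have := sqr_ge0 a; have := sqr_ge0 b.
by rewrite ler_norml => *; apply/andP; split; lra.
Qed.

Lemma integrable_coordM u v k : L2 u -> L2 v ->
  P.-integrable [set: T] (EFin \o (fun t => u t 0 k * v t 0 k)).
Proof.
move=> [mu iu] [mv iv].
apply: (@le_integrable_EFin _ (fun t => nsq (u t) + nsq (v t))).
- exact: measurable_funM (mu k) (mv k).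
- by move=> t; exact: norm_coordM_le.
- exact: integrable_EFinD.
Qed.

Lemma integrable_EFin_sum (I : Type) (r : seq I) (f : I -> T -> R) :
  (forall i, P.-integrable [set: T] (EFin \o f i)) ->
  P.-integrable [set: T] (EFin \o (fun t => \sum_(i <- r) f i t)) /\
  \int[P]_t (\sum_(i <- r) f i t) = \sum_(i <- r) \int[P]_t f i t.
Proof.
move=> fi; elim: r => [|i r [ir IH]].
  under eq_Rintegral do rewrite big_nil.
  rewrite big_nil Rintegral_cst// mul0r; split => //.
  under eq_fun do rewrite big_nil.
  exact: integrable_EFin_cst.
rewrite big_cons -IH; split.
  under eq_fun do rewrite big_cons; exact: integrable_EFinD.
by under eq_Rintegral do rewrite big_cons; rewrite RintegralD.
Qed.

Lemma integrable_dot u v : L2 u -> L2 v ->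
  P.-integrable [set: T] (EFin \o (fun t => dot (u t) (v t))).
Proof.
move=> Lu Lv; under eq_fun do rewrite dotE.
by have [] := @integrable_EFin_sum _ (index_enum 'I_M)
  (fun k t => u t 0 k * v t 0 k) (fun k => integrable_coordM k Lu Lv).
Qed.

Lemma le_msq_comb (f p u v : T -> 'rV[R]_M) (e a b : R) :
  L2 f -> L2 p -> L2 u -> L2 v ->
  (forall t, nsq (f t) + e * nsq (p t) <= a * nsq (u t) + b * nsq (v t)) ->
  msq f + e * msq p <= a * msq u + b * msq v.
Proof.
move=> [_ fi] [_ pi] [_ ui] [_ vi] h; rewrite /msq.
rewrite -!RintegralZl// -!RintegralD//; try exact: integrable_EFinZ.
by apply: le_Rintegral => //; apply: integrable_EFinD => //; exact: integrable_EFinZ.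
Qed.

Lemma le_msq (f u : T -> 'rV[R]_M) (a : R) : L2 f -> L2 u ->
  (forall t, nsq (f t) <= a * nsq (u t)) -> msq f <= a * msq u.
Proof.
move=> Lf Lu h; have := @le_msq_comb f f u u 0 a 0 Lf Lf Lu Lu.
by rewrite !mul0r !addr0; apply=> t; rewrite !mul0r !addr0.
Qed.

Lemma msqZ a v : L2 v -> msq (fun t => a *: v t) = a ^+ 2 * msq v.
Proof.
move=> [_ iv]; rewrite /msq; under eq_Rintegral do rewrite nsqZ.
by rewrite RintegralZl.
Qed.

Lemma msqB_le u v : L2 u -> L2 v ->
  msq (fun t => u t - v t) <= 2 * msq u + 2 * msq v.
Proof.
move=> Lu Lv; have LB := L2B Lu Lv.
have := @le_msq_comb _ _ u v 0 2 2 LB LB Lu Lv.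
by rewrite mul0r addr0; apply=> t; rewrite mul0r addr0; exact: nsqB_le.
Qed.

Section conditioning.
Variable G : set (set T).
Hypothesis hG : <<s G >> `<=` (@measurable _ T).

Lemma L2_condexp_le (s p : T -> 'rV[R]_M) (a b : R) : 0 <= a -> 0 <= b ->
  vec_measurable s -> L2 p ->
  condexp_le P G (fun t => nsq (s t)) (fun t => a * nsq (p t) + b) ->
  L2 s /\ msq s <= a * msq p + b.
Proof.
move=> a0 b0 ms [mp ip] /(condexp_le_integral hG)[].
- apply: measurable_funD => //; apply: measurable_funM => //; exact: measurable_nsq.
- by move=> t; rewrite addr_ge0// mulr_ge0// nsq_ge0.
move=> mns ns0 le.
have iY : P.-integrable [set: T] (EFin \o (fun t => a * nsq (p t) + b)).
  apply: integrable_EFinD; first exact: integrable_EFinZ.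
  exact: integrable_EFin_cst.
have ltY := integrable_lty measurableT iY.
have is_ : P.-integrable [set: T] (EFin \o (fun t => nsq (s t))).
  apply/integrableP; split; first exact/measurable_EFinP.
  apply: le_lt_trans ltY; apply: le_trans le; rewrite le_eqVlt; apply/orP; left.
  by apply/eqP/eq_integral => t _; rewrite /= ger0_norm.
split; first by split.
have P1 : fine (P [set: T]) = 1 by rewrite probability_setT.
have <- : \int[P]_t (a * nsq (p t) + b) = a * msq p + b.
  rewrite RintegralD//; [|exact: integrable_EFinZ|exact: integrable_EFin_cst].
  rewrite RintegralZl// Rintegral_cst// -[RHS]/(_ + b) -[in RHS](mulr1 b).
  by congr (_ + _ * _); exact: P1.
by apply: fine_le => //; exact: integrable_fin_num.
Qed.

(** Unlike a vanishing conditional expectation, this weak form of centring is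
    stable under differences without constructing any new conditional
    expectation; it is all that the mean-square estimates use. *)
Definition uncorrelated_with_past (s : T -> 'rV[R]_M) :=
  forall U : T -> 'rV[R]_M,
    vec_measurable (U : g_sigma_algebraType G -> 'rV[R]_M) -> L2 U ->
    \int[P]_t dot (U t) (s t) = 0.

Lemma condexp_eq0_uncorrelated (s : T -> 'rV[R]_M) : L2 s ->
  (forall k, condexp_eq0 P G (fun t => s t 0 k)) -> uncorrelated_with_past s.
Proof.
move=> Ls s0 U mU LU; under eq_Rintegral do rewrite dotE.
have [_ ->] := @integrable_EFin_sum _ (index_enum 'I_M)
  (fun k t => U t 0 k * s t 0 k) (fun k => integrable_coordM k LU Ls).
rewrite big1// => k _.
apply: (condexp_eq0_orthogonal hG (U := fun t => U t 0 k) _ (s0 k)).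
  exact: mU k.
exact: integrable_coordM.
Qed.

Lemma uncorrelatedB (s s' : T -> 'rV[R]_M) : L2 s -> L2 s' ->
  uncorrelated_with_past s -> uncorrelated_with_past s' ->
  uncorrelated_with_past (fun t => s t - s' t).
Proof.
move=> Ls Ls' us us' U mU LU.
under eq_Rintegral do rewrite dotDr dotNr.
rewrite RintegralB//; try exact: integrable_dot.
by rewrite us// us'// subrr.
Qed.

Lemma msq_noise (U s : T -> 'rV[R]_M) (a : R) :
  vec_measurable (U : g_sigma_algebraType G -> 'rV[R]_M) -> L2 U -> L2 s ->
  uncorrelated_with_past s ->
  msq (fun t => U t - a *: s t) = msq U + a ^+ 2 * msq s.
Proof.
move=> mU LU Ls us.
have iUs := integrable_dot LU Ls.
have [_ iU] := LU; have [_ is_] := Ls.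
rewrite /msq.
under eq_Rintegral do rewrite nsqB dotZr nsqZ addrAC.
under eq_Rintegral do rewrite mulrA.
rewrite RintegralB//; last 2 first.
- by apply: integrable_EFinD => //; exact: integrable_EFinZ.
- exact: integrable_EFinZ.
rewrite RintegralD//; last exact: integrable_EFinZ.
by rewrite !RintegralZl// us// mulr0 subr0.
Qed.

(** One step [U - a s] of a stochastic recursion, where [U] is known from the
    past and [s] is noise whose conditional variance is controlled at the point
    [p]: a pointwise bound on the drift, with the variance already included,
    becomes a bound on mean squares. *)
Lemma stochastic_step (U u v p s : T -> 'rV[R]_M) (a A B Gam sg : R) :
  0 <= Gam -> 0 <= sg ->
  vec_measurable (U : g_sigma_algebraType G -> 'rV[R]_M) ->
  L2 U -> L2 u -> L2 v -> L2 p -> vec_measurable s ->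
  uncorrelated_with_past s ->
  condexp_le P G (fun t => nsq (s t)) (fun t => Gam * nsq (p t) + sg) ->
  (forall t, nsq (U t) + a ^+ 2 * (Gam * nsq (p t)) <=
    A * nsq (u t) + B * nsq (v t)) ->
  L2 (fun t => U t - a *: s t) /\
  msq (fun t => U t - a *: s t) <= A * msq u + B * msq v + a ^+ 2 * sg.
Proof.
move=> Gam0 sg0 mU LU Lu Lv Lp ms us sle h.
have [Ls les] := L2_condexp_le Gam0 sg0 ms Lp sle.
split; first by apply: L2B => //; exact: L2Z.
rewrite msq_noise//.
have hh t : nsq (U t) + (a ^+ 2 * Gam) * nsq (p t) <=
    A * nsq (u t) + B * nsq (v t) by rewrite -mulrA.
have := le_msq_comb LU Lp Lu Lv hh.
have : a ^+ 2 * msq s <= a ^+ 2 * (Gam * msq p + sg).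
  by rewrite ler_wpM2l// sqr_ge0.
lra.
Qed.

End conditioning.
End square_integrable_vectors.

(** * Coupled scalar recursions *)

Section scalar_recursion.
Context {R : realType}.

(** All smallness conditions on the step-size have the form [mu * X <= Y]. *)
Lemma small_step_exists (s : seq (R * R)) :
  all (fun p => (0 <= p.1) && (0 < p.2)) s ->
  exists2 m : R, 0 < m & forall mu, 0 < mu < m -> all (fun p => mu * p.1 <= p.2) s.
Proof.
elim: s => [_|[X Y] s IH /= /andP[/andP[/= X0 Y0] /IH [m m0 hm]]].
  by exists 1.
exists (Num.min m (Y / (X + 1))).
  by rewrite lt_min m0 divr_gt0// ltr_wpDl.
move=> mu /andP[mu0]; rewrite lt_min => /andP[mum muY].
apply/andP; split; last by apply: hm; rewrite mu0.
have X1 : 0 < X + 1 by rewrite ltr_wpDl.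
move: muY; rewrite ltr_pdivlMr// mulrDr mulr1 /= => h; lra.
Qed.

(** The rate [1 - mu nu / 2] is slower than the rate [1 - mu nu] of the
    recursions for [a] and [e]; the difference absorbs the coupling terms.
    The coupling is triangular at leading order: [A] is fixed by the initial
    value, then [D] must dominate [A], and then [E] must dominate [D]. *)
Lemma coupled_recursion (mu nu beta K1 K2 K3 s2 A D E : R) (a d e : nat -> R) :
  0 < mu -> 0 < nu -> 0 <= beta < 1 -> 0 <= K1 -> 0 <= K2 -> 0 <= s2 ->
  0 <= A -> 0 <= D -> 0 <= E ->
  mu <= 1 -> mu * nu <= 1 ->
  mu * (K3 + nu / 2) <= (1 - beta) / 2 -> 0 <= K3 ->
  mu * (K1 * D) <= nu * A / 2 -> mu <= nu * A / 2 ->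
  2 * (K2 * A + 1) <= (1 - beta) * D -> 2 * (K1 * D) <= nu * E ->
  a 0%N <= A -> d 0%N <= D * mu ^+ 2 -> e 0%N <= E * mu ^+ 2 ->
  (forall n, a n.+1 <= (1 - mu * nu) * a n + mu * K1 * d n + mu ^+ 2 * s2) ->
  (forall n, d n.+1 <= (beta + mu ^+ 2 * K3) * d n + mu ^+ 2 * K2 * a n
     + mu ^+ 2 * s2) ->
  (forall n, e n.+1 <= (1 - mu * nu) * e n + mu * K1 * d n) ->
  forall n, let q := (1 - mu * nu / 2) ^+ n in
  d n <= D * mu ^+ 2 * (q + s2) /\ e n <= E * mu ^+ 2 * (q + s2).
Proof.
move=> mu0 nu0 /andP[b0 b1] K10 K20 s0 A0 D0 E0 mu1 munu hb K30 hKD hA hD hE.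
move=> a0 d0 e0 ha hd he n.
suff : a n <= A * ((1 - mu * nu / 2) ^+ n + s2) /\
  (d n <= D * mu ^+ 2 * ((1 - mu * nu / 2) ^+ n + s2) /\
   e n <= E * mu ^+ 2 * ((1 - mu * nu / 2) ^+ n + s2)) by case.
have m20 : 0 <= mu ^+ 2 by exact: sqr_ge0.
elim: n => [|n [IHa [IHd IHe]]].
  rewrite expr0; split; [|split].
  - by rewrite (le_trans a0)// ler_peMr// lerDl.
  - by rewrite (le_trans d0)// ler_peMr ?lerDl// mulr_ge0.
  - by rewrite (le_trans e0)// ler_peMr ?lerDl// mulr_ge0.
rewrite exprS; set r := 1 - mu * nu / 2; rewrite -/r in IHa IHd IHe.
have r0 : 0 <= r by rewrite /r; have := mulr_gt0 mu0 nu0; lra.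
set q := r ^+ n in IHa IHd IHe *.
have q0 : 0 <= q by rewrite exprn_ge0.
have munu0 := mulr_gt0 mu0 nu0.
have qs : 0 <= q + s2 by rewrite addr_ge0.
have rE : r = 1 - mu * nu / 2 by [].
have k1 : mu * K1 * d n <= mu * K1 * (D * mu ^+ 2 * (q + s2)).
  by rewrite ler_wpM2l// mulr_ge0// ltW.
split; [|split].
- apply: le_trans (ha n) _.
  have h1 : (1 - mu * nu) * a n <= (1 - mu * nu) * (A * (q + s2)).
    by rewrite ler_wpM2l// subr_ge0.
  have h2 : mu * K1 * (D * mu ^+ 2 * (q + s2)) <= mu * (nu * A / 2) * (q + s2).
    have -> : mu * K1 * (D * mu ^+ 2 * (q + s2)) =
      mu * (mu * (mu * (K1 * D))) * (q + s2) by ring.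
    have KD0 : 0 <= mu * (K1 * D) by apply: mulr_ge0; [exact: ltW | exact: mulr_ge0].
    apply: ler_wpM2r => //; apply: ler_wpM2l; first exact: ltW.
    by apply: le_trans hKD; exact: ler_piMl.
  have h3 : mu * mu * s2 <= mu * (nu * A / 2) * s2.
    by apply: ler_wpM2r => //; apply: ler_wpM2l => //; exact: ltW.
  rewrite rE; lra.
- apply: le_trans (hd n) _.
  have h0 : mu ^+ 2 * K3 <= mu * K3.
    apply: ler_wpM2r => //; rewrite expr2; apply: ler_piMl => //; exact: ltW.
  have h1 : (beta + mu ^+ 2 * K3) * d n <=
      (beta + mu ^+ 2 * K3) * (D * mu ^+ 2 * (q + s2)).
    by rewrite ler_wpM2l// addr_ge0// mulr_ge0.
  have h2 : mu ^+ 2 * K2 * a n <= mu ^+ 2 * K2 * (A * (q + s2)).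
    by rewrite ler_wpM2l// mulr_ge0.
  have h3 : (beta + mu ^+ 2 * K3 + mu * nu / 2) * (D * mu ^+ 2 * (q + s2)) <=
      (beta + (1 - beta) / 2) * (D * mu ^+ 2 * (q + s2)).
    by apply: ler_wpM2r; [do 2![apply: mulr_ge0 => //] | lra].
  have h4 : mu ^+ 2 * (q + s2) * (2 * (K2 * A + 1)) <=
      mu ^+ 2 * (q + s2) * ((1 - beta) * D).
    by rewrite ler_wpM2l// mulr_ge0.
  have h5 : 0 <= mu ^+ 2 * q by rewrite mulr_ge0.
  have h6 : 0 <= mu * nu / 2 * (D * mu ^+ 2 * s2).
    by apply: mulr_ge0; [lra | apply: mulr_ge0 => //; exact: mulr_ge0].
  rewrite rE; lra.
- apply: le_trans (he n) _.
  have h1 : (1 - mu * nu) * e n <= (1 - mu * nu) * (E * mu ^+ 2 * (q + s2)).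
    by rewrite ler_wpM2l// subr_ge0.
  have h2 : mu * mu ^+ 2 * (q + s2) * (2 * (K1 * D)) <=
      mu * mu ^+ 2 * (q + s2) * (nu * E).
    by apply: ler_wpM2l => //; do 2![apply: mulr_ge0 => //]; exact: ltW.
  have h3 : 0 <= mu * nu / 2 * (E * mu ^+ 2 * s2).
    by apply: mulr_ge0; [lra | apply: mulr_ge0 => //; exact: mulr_ge0].
  rewrite rE; lra.
Qed.

Lemma recursion_constants (nu beta K1 K2 A B : R) :
  0 < nu -> beta < 1 -> 0 <= K1 -> 0 <= K2 -> 0 <= A -> 0 <= B ->
  exists D E, [/\ 0 <= D, 0 <= E, B <= D, B <= E &
    2 * (K2 * A + 1) <= (1 - beta) * D /\ 2 * (K1 * D) <= nu * E].
Proof.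
move=> nu0 b1 K10 K20 A0 B0.
have b0 : 0 < 1 - beta by rewrite subr_gt0.
have KA0 : 0 <= 2 * (K2 * A + 1) by rewrite mulr_ge0 ?addr_ge0 ?mulr_ge0.
exists (B + 2 * (K2 * A + 1) / (1 - beta)); set D := B + _.
have D0 : 0 <= D by rewrite addr_ge0// divr_ge0// ltW.
have KD0 : 0 <= 2 * (K1 * D) by rewrite mulr_ge0 ?mulr_ge0.
exists (B + 2 * (K1 * D) / nu); split.
- by [].
- by rewrite addr_ge0// divr_ge0// ltW.
- by rewrite lerDl divr_ge0// ltW.
- by rewrite lerDl divr_ge0// ltW.
- have cancel (a y : R) : 0 < a -> a * (y / a) = y.
    by move=> a0; rewrite mulrC divfK// gt_eqF.
  split; rewrite [in leRHS]/D ?[leRHS]mulrDr cancel// lerDr.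
    by rewrite mulr_ge0// ltW.
  by rewrite mulr_ge0// ltW.
Qed.

End scalar_recursion.

(** * The momentum recursion in averaged coordinates *)

Lemma succz_pred (n : nat) : n.+1%:Z - 1 = n%:Z.
Proof. by lia. Qed.

Lemma succz_pred2 (n : nat) : n.+1%:Z - 2 = n%:Z - 1.
Proof. by lia. Qed.

Section trajectories.
Context {d d' : measure_display} {Omega : measurableType d}
  {Theta : measurableType d'} {R : realType} {M : nat}.
Variables (P : probability Omega R) (Q : 'rV[R]_M -> Theta -> R)
  (thetas : int -> Omega -> Theta) (J : 'rV[R]_M -> R)
  (init : Omega -> 'rV[R]_M) (mu mum beta1 beta2 beta : R)
  (x w psi : int -> Omega -> 'rV[R]_M).
Let g := fun v t => grad (Q^~ t) v.
Let s := gradient_noise Q J thetas.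
Let F := history w psi x.
Hypotheses (beta_lt1 : beta < 1) (betaD : beta1 + beta2 = beta)
  (betaM : beta1 * beta2 = 0) (muE : mu = mum / (1 - beta)).
Hypothesis sgdx : sgd g thetas mu init x.
Hypothesis momw : momentum_sgd g thetas mum beta1 beta2 init w psi.

(** Time is shifted by one: index [n] stands for the state known before the
    sample number [n] is used, so that all recursions start at [0]. *)
Definition increment (n : nat) o : 'rV[R]_M := w (n%:Z - 1) o - w (n%:Z - 2) o.
Definition averaged (n : nat) o : 'rV[R]_M :=
  w (n%:Z - 1) o + (beta / (1 - beta)) *: increment n o.

(** The stochastic gradient is evaluated at [psi], which lies behind the averaged
    iterate by [lag] times the increment. *)
Definition lag : R := beta / (1 - beta) - beta1.

Let b1 : 1 - beta != 0. Proof. by rewrite subr_eq0 gt_eqF. Qed.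

Let mumE : mum = mu * (1 - beta). Proof. by rewrite muE divfK. Qed.

Lemma gradE i v o : g (v o) (thetas i o) = grad J (v o) + s i v o.
Proof. by rewrite /s /gradient_noise addrC subrK. Qed.

Lemma psi_extrapolation (n : nat) o :
  psi (n%:Z - 1) o = w (n%:Z - 1) o + beta1 *: increment n o.
Proof. by have [_ _ _ h _] := momw; rewrite h. Qed.

Lemma psi_averaged (n : nat) o :
  psi (n%:Z - 1) o = averaged n o - lag *: increment n o.
Proof.
by rewrite psi_extrapolation /averaged /lag -addrA -scalerBl opprB addrCA subrr addr0.
Qed.

(** Since [beta1 * beta2 = 0], the second momentum term acts on the increments of
    [w] as if [psi] were [w]. *)
Lemma psi_increment (n : nat) o :
  beta2 *: (psi (n%:Z - 1) o - psi (n%:Z - 2) o) = beta2 *: increment n o.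
Proof.
rewrite psi_extrapolation.
have [w2 psi2 _ _ _] := momw.
have h (a b c : 'rV[R]_M) :
    beta2 *: (a + beta1 *: (a - b) - (b + beta1 *: c)) = beta2 *: (a - b).
  rewrite opprD addrACA -scalerBr scalerDr scalerA (mulrC beta2).
  by rewrite betaM scale0r addr0.
case: n => [|n].
  by have := h (w (0%:Z - 1) o) (w (0%:Z - 2) o) 0; rewrite scaler0 addr0 psi2 -w2.
rewrite succz_pred2 psi_extrapolation.
have -> : w (n%:Z - 1) o = w (n.+1%:Z - 2) o by congr (w _ o); lia.
exact: h.
Qed.

Lemma incrementS (n : nat) o : increment n.+1 o =
  (beta *: increment n o - (mu * (1 - beta)) *: grad J (psi (n%:Z - 1) o))
  - (mu * (1 - beta)) *: s n%:Z (psi (n%:Z - 1)) o.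
Proof.
rewrite -mumE {1}/increment succz_pred succz_pred2.
have [_ _ _ _ ->//] := momw.
rewrite psi_increment gradE -betaD; move: (grad J _) (s _ _ _) => G S.
rewrite psi_extrapolation; move: (increment n o) (w _ _) => D W.
by apply/rowP => k; rewrite !mxE; ring.
Qed.

Lemma averagedS (n : nat) o : averaged n.+1 o =
  (averaged n o - mu *: grad J (psi (n%:Z - 1) o))
  - mu *: s n%:Z (psi (n%:Z - 1)) o.
Proof.
have wS : w (n.+1%:Z - 1) o = w (n%:Z - 1) o + increment n.+1 o.
  rewrite /increment succz_pred2.
  by rewrite [RHS]addrC subrK.
rewrite /averaged wS incrementS.
move: (grad J _) (s _ _ _) (increment n o) (w _ _) => G S D W.
by apply/rowP => k; rewrite !mxE; field.
Qed.

Lemma sgdS (n : nat) o : x (n.+1%:Z - 1) o =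
  (x (n%:Z - 1) o - mu *: grad J (x (n%:Z - 1) o))
  - mu *: s n%:Z (x (n%:Z - 1)) o.
Proof.
rewrite succz_pred.
have [_ ->//] := sgdx.
by rewrite gradE scalerDr opprD addrA.
Qed.

Lemma x0E : x (0%:Z - 1) = init. Proof. by case: sgdx. Qed.

Lemma w0E : w (-2) = init. Proof. by case: momw. Qed.

Lemma increment0 o : increment 0 o =
  - (mu * (1 - beta)) *: (grad J (init o) + s (-1) init o).
Proof.
rewrite /increment -mumE; have [<- _ -> _ _] := momw.
by rewrite gradE scaleNr addrC addKr.
Qed.

Lemma averaged0 o : averaged 0 o =
  init o - mu *: (grad J (init o) + s (-1) init o).
Proof.
rewrite /averaged increment0.
have -> : w (0%:Z - 1) o = init o + increment 0 o.
  by rewrite /increment -[X in w (X - _)]/(0%:Z) sub0r w0E [RHS]addrC subrK.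
rewrite increment0; move: (grad J _) (s _ _ _) => G S.
by apply/rowP => k; rewrite !mxE; field.
Qed.

Lemma iterate_diff (n : nat) o : w (n%:Z - 1) o - x (n%:Z - 1) o =
  (averaged n o - x (n%:Z - 1) o) - (beta / (1 - beta)) *: increment n o.
Proof. by rewrite /averaged addrAC addrK. Qed.

Section measurability.

Definition adapted (i : int) (v : Omega -> 'rV[R]_M) :=
  vec_measurable (v : g_sigma_algebraType (F i) -> 'rV[R]_M).

Lemma w_adapted (j t : int) : -2 <= j <= t -> adapted t (w j).
Proof.
move=> jt k _ B mB; rewrite setTI; apply: sub_sigma_algebra.
by left; left; exists j, k, B.
Qed.

Lemma psi_adapted (j t : int) : -2 <= j <= t -> adapted t (psi j).
Proof.
move=> jt k _ B mB; rewrite setTI; apply: sub_sigma_algebra.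
by left; right; exists j, k, B.
Qed.

Lemma x_adapted (j t : int) : -1 <= j <= t -> adapted t (x j).
Proof.
move=> jt k _ B mB; rewrite setTI; apply: sub_sigma_algebra.
by right; exists j, k, B.
Qed.

Hypothesis cgrad : continuous (grad J).
Hypothesis minit : vec_measurable init.
Hypothesis ms : forall (i : int) (v : Omega -> 'rV[R]_M), -1 <= i ->
  adapted (i - 1) v -> vec_measurable (s i v).

Lemma noise_psi_measurable (n : nat) : vec_measurable (s n%:Z (psi (n%:Z - 1))).
Proof. by apply: ms; [lia | apply: psi_adapted; lia]. Qed.

Lemma noise_x_measurable (n : nat) : vec_measurable (s n%:Z (x (n%:Z - 1))).
Proof. by apply: ms; [lia | apply: x_adapted; lia]. Qed.

Lemma noise_init_measurable : vec_measurable (s (-1) init).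
Proof. by apply: ms => //; rewrite -w0E; apply: w_adapted. Qed.

Lemma x_measurable (n : nat) : vec_measurable (x (n%:Z - 1)).
Proof.
elim: n => [|n IH]; first by rewrite x0E.
rewrite (funext (sgdS n)); apply: vec_measurableB.
  apply: vec_measurableB => //; apply: vec_measurableZ.
  exact: (continuous_map_vec_measurable cgrad IH).
by apply: vec_measurableZ; exact: noise_x_measurable.
Qed.

Lemma momentum_measurable (n : nat) :
  vec_measurable (increment n) /\ vec_measurable (averaged n).
Proof.
elim: n => [|n [mD mA]].
  have mg : vec_measurable (fun o => grad J (init o) + s (-1) init o).
    apply: vec_measurableD; last exact: noise_init_measurable.
    exact: (continuous_map_vec_measurable cgrad minit).
  rewrite (funext increment0) (funext averaged0).
  by split; [|apply: vec_measurableB => //]; exact: vec_measurableZ.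
have mpsi : vec_measurable (fun o => grad J (psi (n%:Z - 1) o)).
  apply: (continuous_map_vec_measurable cgrad).
  rewrite (funext (psi_averaged n)).
  by apply: vec_measurableB => //; exact: vec_measurableZ.
have mS := noise_psi_measurable n.
rewrite (funext (incrementS n)) (funext (averagedS n)).
by split; apply: vec_measurableB; try exact: vec_measurableZ;
  apply: vec_measurableB => //; exact: vec_measurableZ.
Qed.

Lemma w_measurable (j : int) : -2 <= j -> vec_measurable (w j).
Proof.
move=> j2; have [-> | j1] := eqVneq j (-2); first by rewrite w0E.
have -> : j = (absz (j + 1))%:Z - 1 by lia.
move: (absz (j + 1)) => n; have [mD mA] := momentum_measurable n.
have -> : w (n%:Z - 1) =
    (fun o => averaged n o - (beta / (1 - beta)) *: increment n o).
  by apply/funext => o; rewrite /averaged addrK.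
by apply: vec_measurableB => //; exact: vec_measurableZ.
Qed.

Lemma psi_measurable (j : int) : -2 <= j -> vec_measurable (psi j).
Proof.
move=> j2; have [-> | j1] := eqVneq j (-2); first by case: momw => _ ->.
have -> : j = (absz (j + 1))%:Z - 1 by lia.
move: (absz (j + 1)) => n; have [mD mA] := momentum_measurable n.
rewrite (funext (psi_averaged n)).
by apply: vec_measurableB => //; exact: vec_measurableZ.
Qed.

(** Measurability of the iterates rests on that of the noise, which is part of
    the hypothesis that its conditional expectation vanishes. *)
Lemma history_measurable (t : int) : <<s (F t) >> `<=` (@measurable _ Omega).
Proof.
apply: smallest_sub; first exact: sigma_algebra_measurable.
move=> A [[]|] [j [k [B [/andP[j1 jt] mB ->]]]]; rewrite -[X in measurable X]setTI.
- exact: (w_measurable j1).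
- exact: (psi_measurable j1).
- have -> : j = (absz (j + 1))%:Z - 1 by lia.
  exact: (@x_measurable _ k).
Qed.

Variables (wo : 'rV[R]_M) (nu delta gamma sigma xi1 : R).
Hypotheses (mu0 : 0 < mu) (nu0 : 0 < nu) (delta0 : 0 < delta)
  (beta01 : 0 <= beta < 1).
Hypothesis mono : forall a b,
  nu * nsq (a - b) <= dot (grad J a - grad J b) (a - b).
Hypothesis lip : forall a b,
  nsq (grad J a - grad J b) <= delta ^+ 2 * nsq (a - b).
Hypothesis grad_wo : grad J wo = 0.
Hypothesis Linit : L2 P (fun o => init o - wo).
Hypothesis noise0 : forall (i : int) (v : Omega -> 'rV[R]_M), -1 <= i ->
  adapted (i - 1) v -> forall k, condexp_eq0 P (F (i - 1)) (fun o => s i v o 0 k).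
Hypothesis noise2 : forall (i : int) (v : Omega -> 'rV[R]_M), -1 <= i ->
  adapted (i - 1) v -> condexp_le P (F (i - 1)) (fun o => enorm (s i v o) ^+ 2)
    (fun o => gamma ^+ 2 * enorm (wo - v o) ^+ 2 + sigma ^+ 2).
Hypothesis noise_diff : forall i : int, 0 <= i -> condexp_le P (F (i - 1))
  (fun o => enorm (s i (psi (i - 1)) o - s i (x (i - 1)) o) ^+ 2)
  (fun o => xi1 * enorm (psi (i - 1) o - x (i - 1) o) ^+ 2).
Hypothesis small_gamma : mu * (delta ^+ 2 + gamma ^+ 2) <= nu / 4.
Hypothesis small_xi : mu * (delta ^+ 2 + `|xi1|) <= nu / 4.

Definition deviation (n : nat) o := averaged n o - wo.
Definition gap (n : nat) o := averaged n o - x (n%:Z - 1) o.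

Lemma increment_adapted (n : nat) : adapted (n%:Z - 1) (increment n).
Proof. by apply: vec_measurableB; apply: w_adapted; lia. Qed.

Lemma averaged_adapted (n : nat) : adapted (n%:Z - 1) (averaged n).
Proof.
apply: vec_measurableD; first by apply: w_adapted; lia.
by apply: vec_measurableZ; exact: increment_adapted.
Qed.

Lemma noise_bound (i : int) (v : Omega -> 'rV[R]_M) : -1 <= i ->
  adapted (i - 1) v -> condexp_le P (F (i - 1)) (fun o => nsq (s i v o))
    (fun o => gamma ^+ 2 * nsq (v o - wo) + sigma ^+ 2).
Proof.
move=> i1 mv; have := noise2 i1 mv; apply: condexp_le_mono => o.
by rewrite -opprB -[X in _ * X + _]/(nsq _) nsqN.
Qed.

Lemma noise_L2 (i : int) (v : Omega -> 'rV[R]_M) : -1 <= i ->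
  adapted (i - 1) v -> L2 P (fun o => v o - wo) ->
  L2 P (s i v) /\
  msq P (s i v) <= gamma ^+ 2 * msq P (fun o => v o - wo) + sigma ^+ 2.
Proof.
move=> i1 mv Lv.
apply: (L2_condexp_le (@history_measurable (i - 1))) (noise_bound i1 mv) => //.
- exact: sqr_ge0.
- exact: sqr_ge0.
- exact: ms.
Qed.

Lemma noise_uncorrelated (i : int) (v : Omega -> 'rV[R]_M) : -1 <= i ->
  adapted (i - 1) v -> L2 P (fun o => v o - wo) ->
  uncorrelated_with_past P (F (i - 1)) (s i v).
Proof.
move=> i1 mv Lv; have [Ls _] := noise_L2 i1 mv Lv.
exact: (condexp_eq0_uncorrelated (@history_measurable (i - 1)) Ls (noise0 i1 mv)).
Qed.

Lemma grad_L2 (u v : Omega -> 'rV[R]_M) : vec_measurable u -> vec_measurable v ->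
  L2 P (fun o => u o - v o) -> L2 P (fun o => grad J (u o) - grad J (v o)).
Proof.
move=> mu' mv Luv; apply: (L2_dominated (a := delta ^+ 2) _ Luv) => [|o]; last exact: lip.
by apply: vec_measurableB; exact: (continuous_map_vec_measurable cgrad).
Qed.

Section one_step.
Variable n : nat.
Hypotheses (Ldev : L2 P (deviation n)) (Linc : L2 P (increment n))
  (Lgap : L2 P (gap n)).

Let psi_n : Omega -> 'rV[R]_M := psi (n%:Z - 1).
Let x_n : Omega -> 'rV[R]_M := x (n%:Z - 1).
Let hF := @history_measurable (n%:Z - 1).
Let apsi : adapted (n%:Z - 1) psi_n. Proof. by apply: psi_adapted; lia. Qed.
Let ax : adapted (n%:Z - 1) x_n. Proof. by apply: x_adapted; lia. Qed.
Let n1 : -1 <= n%:Z. Proof. by lia. Qed.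

Let psi_dev : (fun o => psi_n o - wo) =
  (fun o => deviation n o - lag *: increment n o).
Proof. by apply/funext => o; rewrite /psi_n psi_averaged /deviation addrAC. Qed.

Let psi_gap : (fun o => psi_n o - x_n o) =
  (fun o => gap n o - lag *: increment n o).
Proof. by apply/funext => o; rewrite /psi_n psi_averaged /gap addrAC. Qed.

Let Lpsi : L2 P (fun o => psi_n o - wo).
Proof. by rewrite psi_dev; apply: L2B => //; exact: L2Z. Qed.

Let Lx : L2 P (fun o => x_n o - wo).
Proof.
rewrite (_ : (fun o => _) = (fun o => deviation n o - gap n o)).
  exact: L2B.
by apply/funext => o; rewrite /deviation /gap opprB [RHS]addrC addrA subrK.
Qed.

Let Lpsix : L2 P (fun o => psi_n o - x_n o).
Proof. by rewrite psi_gap; apply: L2B => //; exact: L2Z. Qed.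

Let mpsi : vec_measurable psi_n. Proof. exact: (sub_sigma_vec_measurable hF apsi). Qed.
Let mx : vec_measurable x_n. Proof. exact: (sub_sigma_vec_measurable hF ax). Qed.

Let Lgrad : L2 P (fun o => grad J (psi_n o)).
Proof.
have := grad_L2 mpsi (@vec_measurable_cst _ _ _ _ wo) Lpsi.
by under eq_fun do rewrite grad_wo subr0.
Qed.

Let agrad (v : Omega -> 'rV[R]_M) : adapted (n%:Z - 1) v ->
  adapted (n%:Z - 1) (fun o => grad J (v o)).
Proof. exact: (continuous_map_vec_measurable cgrad). Qed.

Let psiE o : psi_n o - wo = deviation n o - lag *: increment n o.
Proof. exact: (congr1 (@^~ o) psi_dev). Qed.

Let lip_wo o : nsq (grad J (psi_n o)) <= delta ^+ 2 * nsq (psi_n o - wo).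
Proof. by have := lip (psi_n o) wo; rewrite grad_wo subr0. Qed.

Lemma deviation_step : L2 P (deviation n.+1) /\
  msq P (deviation n.+1) <= (1 - mu * nu) * msq P (deviation n)
    + mu * ((2 * delta ^+ 2 / nu + 5 * nu) * lag ^+ 2) * msq P (increment n)
    + mu ^+ 2 * sigma ^+ 2.
Proof.
have -> : deviation n.+1 = (fun o =>
    (deviation n o - mu *: grad J (psi_n o)) - mu *: s n%:Z psi_n o).
  by apply/funext => o; rewrite /deviation averagedS -/psi_n addrAC (addrAC _ _ (- wo)).
apply: (stochastic_step (p := fun o => psi_n o - wo) (Gam := gamma ^+ 2) hF) => //.
- exact: sqr_ge0.
- exact: sqr_ge0.
- apply: vec_measurableB; last by apply: vec_measurableZ; exact: agrad.
  by apply: vec_measurableB; [exact: averaged_adapted | exact: vec_measurable_cst].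
- by apply: L2B => //; exact: L2Z.
- exact: ms.
- exact: noise_uncorrelated.
- exact: noise_bound.
- move=> o; rewrite psiE; apply: drift_step => //; rewrite -psiE //.
  by have := mono (psi_n o) wo; rewrite grad_wo subr0.
Qed.

Lemma increment_step : L2 P (increment n.+1) /\
  msq P (increment n.+1) <=
    mu ^+ 2 * (2 * (delta ^+ 2 + gamma ^+ 2)) * msq P (deviation n)
    + (beta + mu ^+ 2 * (2 * (delta ^+ 2 + gamma ^+ 2) * lag ^+ 2))
      * msq P (increment n)
    + (mu * (1 - beta)) ^+ 2 * sigma ^+ 2.
Proof.
rewrite (funext (incrementS n)) -/psi_n.
apply: (stochastic_step (p := fun o => psi_n o - wo) (Gam := gamma ^+ 2) hF) => //.
- exact: sqr_ge0.
- exact: sqr_ge0.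
- apply: vec_measurableB; first by apply: vec_measurableZ; exact: increment_adapted.
  by apply: vec_measurableZ; exact: agrad.
- by apply: L2B; exact: L2Z.
- exact: ms.
- exact: noise_uncorrelated.
- exact: noise_bound.
- move=> o; rewrite psiE [leRHS]addrC.
  have /andP[b0 bl] := beta01.
  apply: momentum_step; [by rewrite b0 ltW | exact: sqr_ge0 | by rewrite -psiE].
Qed.

(** Both recursions use the same sample, so only the difference of their noises
    enters, and its variance is bounded by the squared distance of the two
    evaluation points: there is no additive noise term. *)
Lemma gap_step : L2 P (gap n.+1) /\
  msq P (gap n.+1) <= (1 - mu * nu) * msq P (gap n)
    + mu * ((2 * delta ^+ 2 / nu + 5 * nu) * lag ^+ 2) * msq P (increment n).
Proof.
have -> : gap n.+1 = (fun o =>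
    (gap n o - mu *: (grad J (psi_n o) - grad J (x_n o)))
    - mu *: (s n%:Z psi_n o - s n%:Z x_n o)).
  apply/funext => o; rewrite /gap averagedS sgdS -/psi_n -/x_n.
  move: (grad J _) (grad J _) (s _ _ _) (s _ _ _) => G1 G2 S1 S2.
  move: (averaged n o) (x_n o) => y z.
  by apply/rowP => k; rewrite !mxE; ring.
rewrite -[X in _ /\ _ <= X]addr0 -[X in _ /\ _ <= _ + X](mulr0 (mu ^+ 2)).
have n0 : 0 <= n%:Z by [].
apply: (stochastic_step (p := fun o => psi_n o - x_n o) (Gam := `|xi1|) hF) => //.
- apply: vec_measurableB; first by apply: vec_measurableB;
    [exact: averaged_adapted | exact: ax].
  by apply: vec_measurableZ; apply: vec_measurableB; exact: agrad.
- by apply: L2B => //; apply: L2Z; exact: grad_L2.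
- by apply: vec_measurableB; exact: ms.
- apply: uncorrelatedB; try exact: noise_uncorrelated.
    by have [] := noise_L2 n1 apsi Lpsi.
  by have [] := noise_L2 n1 ax Lx.
- have := noise_diff n0; apply: condexp_le_mono => o.
  by rewrite addr0 ler_wpM2r ?sqr_ge0// ler_norm.
- move=> o; have E : psi_n o - x_n o = gap n o - lag *: increment n o.
    exact: (congr1 (@^~ o) psi_gap).
  by rewrite E; apply: drift_step => //; rewrite -E.
Qed.

End one_step.

Lemma first_gradient_L2 : L2 P (fun o => grad J (init o) + s (-1) init o) /\
  msq P (fun o => grad J (init o) + s (-1) init o) <=
    2 * (delta ^+ 2 * msq P (fun o => init o - wo))
    + 2 * (gamma ^+ 2 * msq P (fun o => init o - wo) + sigma ^+ 2).
Proof.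
have ainit : adapted (-1 - 1) init by rewrite -w0E; apply: w_adapted.
have [Ls sle] := noise_L2 (lexx (-1)) ainit Linit.
have LG : L2 P (fun o => grad J (init o)).
  have := grad_L2 minit (@vec_measurable_cst _ _ _ _ wo) Linit.
  by under eq_fun do rewrite grad_wo subr0.
have Gle : msq P (fun o => grad J (init o)) <=
    delta ^+ 2 * msq P (fun o => init o - wo).
  apply: le_msq => // o; have := lip (init o) wo.
  by rewrite grad_wo subr0.
split; first exact: L2D.
under eq_fun do rewrite -[s _ _ _]opprK.
apply: le_trans (msqB_le LG (L2N Ls)) _.
have -> : msq P (fun o => - s (-1) init o) = msq P (s (-1) init).
  by apply: eq_Rintegral => o _; rewrite nsqN.
lra.
Qed.

Definition initial_msq := msq P (fun o => init o - wo).
(** Bounds the mean square of the first stochastic gradient, which is evaluated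
    at the initial state and determines all the initial values. *)
Definition first_gradient_bound :=
  2 * (delta ^+ 2 * initial_msq) + 2 * (gamma ^+ 2 * initial_msq + sigma ^+ 2).

Lemma deviation_start : L2 P (deviation 0) /\
  msq P (deviation 0) <= 2 * initial_msq + 2 * (mu ^+ 2 * first_gradient_bound).
Proof.
have [Lg gle] := first_gradient_L2; have Lmg := L2Z mu Lg.
have -> : deviation 0 = (fun o => (init o - wo) -
    mu *: (grad J (init o) + s (-1) init o)).
  by apply/funext => o; rewrite /deviation averaged0 addrAC.
split; first exact: L2B.
apply: le_trans (msqB_le Linit Lmg) _.
by rewrite (msqZ _ Lg) lerD2l ler_pM2l// ler_wpM2l// sqr_ge0.
Qed.

Lemma increment_start : L2 P (increment 0) /\
  msq P (increment 0) <= mu ^+ 2 * first_gradient_bound.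
Proof.
have [Lg gle] := first_gradient_L2.
rewrite (funext increment0); split; first exact: L2Z.
rewrite (msqZ _ Lg) sqrrN exprMn -mulrA ler_wpM2l ?sqr_ge0//.
apply: le_trans gle; apply: ler_piMl; first exact: msq_ge0.
by have /andP[b0 bl] := beta01; apply: exprn_ile1; lra.
Qed.

Lemma gap_start : L2 P (gap 0) /\ msq P (gap 0) <= mu ^+ 2 * first_gradient_bound.
Proof.
have [Lg gle] := first_gradient_L2.
have -> : gap 0 = (fun o => (- mu) *: (grad J (init o) + s (-1) init o)).
  by apply/funext => o; rewrite /gap averaged0 x0E addrAC subrr add0r scaleNr.
split; first exact: L2Z.
by rewrite (msqZ _ Lg) sqrrN ler_wpM2l// sqr_ge0.
Qed.

Lemma all_L2 (n : nat) :
  [/\ L2 P (deviation n), L2 P (increment n) & L2 P (gap n)].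
Proof.
elim: n => [|n [Ld Li Lg]].
  by split; [case: deviation_start|case: increment_start|case: gap_start].
by split; [case: (deviation_step Ld Li)|case: (increment_step Ld Li)
  |case: (gap_step Ld Li Lg)].
Qed.

Lemma iterate_msq (n : nat) :
  L2 P (fun o => w (n%:Z - 1) o - x (n%:Z - 1) o) /\
  msq P (fun o => w (n%:Z - 1) o - x (n%:Z - 1) o) <=
    2 * msq P (gap n) + 2 * ((beta / (1 - beta)) ^+ 2 * msq P (increment n)).
Proof.
have [_ Li Lg] := all_L2 n; rewrite (funext (iterate_diff n)) -(msqZ _ Li).
by split; [apply: L2B => //; exact: L2Z | apply: msqB_le => //; exact: L2Z].
Qed.

Definition increment_gain := (2 * delta ^+ 2 / nu + 5 * nu) * lag ^+ 2.
Definition deviation_gain := 2 * (delta ^+ 2 + gamma ^+ 2).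

(** The constants [A], [D], [E] bound the mean squares of [deviation],
    [increment] and [gap] at all times, relative to [1], [mu ^+ 2] and
    [mu ^+ 2] respectively. *)
Lemma iterates_close (A D E : R) :
  0 <= A -> 0 <= D -> 0 <= E -> mu <= 1 -> mu * nu <= 1 ->
  mu * (deviation_gain * lag ^+ 2 + nu / 2) <= (1 - beta) / 2 ->
  mu * (increment_gain * D) <= nu * A / 2 -> mu <= nu * A / 2 ->
  2 * (deviation_gain * A + 1) <= (1 - beta) * D -> 2 * (increment_gain * D) <= nu * E ->
  2 * initial_msq + 2 * first_gradient_bound <= A -> first_gradient_bound <= D -> first_gradient_bound <= E ->
  forall i : nat, L2 P (fun o => w i%:Z o - x i%:Z o) /\
    msq P (fun o => w i%:Z o - x i%:Z o) <=
      (2 * E + 2 * ((beta / (1 - beta)) ^+ 2 * D)) * mu ^+ 2 *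
      ((1 - mu * nu / 2) ^+ i.+1 + sigma ^+ 2).
Proof.
move=> A0 D0 E0 mu1 munu hb hKD hA hD hE hA0 hD0 hE0 i.
have /andP[b0 bl] := beta01.
have d20 := sqr_ge0 delta; have g20 := sqr_ge0 gamma.
have K20 : 0 <= deviation_gain by rewrite mulr_ge0// addr_ge0.
have K10 : 0 <= increment_gain.
  rewrite mulr_ge0 ?sqr_ge0// addr_ge0//; last by rewrite mulr_ge0// ltW.
  by rewrite divr_ge0 ?mulr_ge0// ltW.
have m20 := sqr_ge0 mu.
have B0 : 0 <= first_gradient_bound by apply: le_trans (msq_ge0 _ _) first_gradient_L2.2.
have mB : mu ^+ 2 * first_gradient_bound <= first_gradient_bound.
  by apply: ler_piMl => //; apply: exprn_ile1 => //; exact: ltW.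
have dev0 : msq P (deviation 0) <= A.
  apply: le_trans deviation_start.2 (le_trans _ hA0).
  by rewrite lerD2l ler_wpM2l.
have inc0 : msq P (increment 0) <= D * mu ^+ 2.
  by apply: le_trans increment_start.2 _; rewrite mulrC ler_wpM2r.
have gap0 : msq P (gap 0) <= E * mu ^+ 2.
  by apply: le_trans gap_start.2 _; rewrite mulrC ler_wpM2r.
have stepd n : msq P (deviation n.+1) <= (1 - mu * nu) * msq P (deviation n)
    + mu * increment_gain * msq P (increment n) + mu ^+ 2 * sigma ^+ 2.
  by have [Ld Li _] := all_L2 n; exact: (deviation_step Ld Li).2.
have stepi n : msq P (increment n.+1) <= (beta + mu ^+ 2 * (deviation_gain * lag ^+ 2))
    * msq P (increment n) + mu ^+ 2 * deviation_gain * msq P (deviation n)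
    + mu ^+ 2 * sigma ^+ 2.
  have [Ld Li _] := all_L2 n; apply: le_trans (increment_step Ld Li).2 _.
  have s0 := sqr_ge0 sigma.
  rewrite [X in X + _ <= _]addrC; apply: lerD => //; rewrite ler_wpM2r//.
  by rewrite exprMn ler_piMr// exprn_ile1 ?subr_ge0 ?gerBl// ltW.
have stepg n : msq P (gap n.+1) <= (1 - mu * nu) * msq P (gap n)
    + mu * increment_gain * msq P (increment n).
  by have [Ld Li Lg] := all_L2 n; exact: (gap_step Ld Li Lg).2.
have [Lwx le_wx] := iterate_msq i.+1.
rewrite succz_pred in Lwx le_wx; split => //; apply: le_trans le_wx _.
have K30 : 0 <= deviation_gain * lag ^+ 2 by rewrite mulr_ge0// sqr_ge0.
have [] := @coupled_recursion R mu nu beta increment_gain deviation_gain (deviation_gain * lag ^+ 2) (sigma ^+ 2) A D E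
  (fun n => msq P (deviation n)) (fun n => msq P (increment n))
  (fun n => msq P (gap n)) mu0 nu0 beta01 K10 K20 (sqr_ge0 sigma) A0 D0 E0
  mu1 munu hb K30 hKD hA hD hE dev0 inc0 gap0 stepd stepi stepg i.+1.
set q := _ ^+ i.+1; set C := (beta / (1 - beta)) ^+ 2 => hi hg.
have C0 : 0 <= C by exact: sqr_ge0.
rewrite (_ : (_ + _) * _ * _ = 2 * (E * mu ^+ 2 * (q + sigma ^+ 2))
  + 2 * (C * (D * mu ^+ 2 * (q + sigma ^+ 2)))); last by ring.
by rewrite lerD// ler_wpM2l// ler_wpM2l.
Qed.

End measurability.
End trajectories.

(** * Choice of the constants and conclusion *)

Section main_estimate.
Context {d d' : measure_display} {Omega : measurableType d}
  {Theta : measurableType d'} {R : realType} {M : nat}.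
Variables (P : probability Omega R) (Q : 'rV[R]_M -> Theta -> R)
  (thetas : int -> Omega -> Theta) (J : 'rV[R]_M -> R) (wo : 'rV[R]_M)
  (init : Omega -> 'rV[R]_M) (nu delta gamma sigma beta1 beta2 beta xi1 : R).
Let g := fun v t => grad (Q^~ t) v.
Let s := gradient_noise Q J thetas.
Hypotheses (nu0 : 0 < nu) (delta0 : 0 < delta) (beta01 : 0 <= beta < 1)
  (betaD : beta1 + beta2 = beta) (betaM : beta1 * beta2 = 0).
Hypothesis mono : forall a b,
  nu * nsq (a - b) <= dot (grad J a - grad J b) (a - b).
Hypothesis lip : forall a b,
  nsq (grad J a - grad J b) <= delta ^+ 2 * nsq (a - b).
Hypotheses (cgrad : continuous (grad J)) (grad_wo : grad J wo = 0).
Hypotheses (minit : vec_measurable init) (Linit : L2 P (fun o => init o - wo)).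

Lemma momentum_close_to_sgd : exists K mubar : R, 0 <= K /\ 0 < mubar /\
  forall mu mum : R, 0 < mu < mubar -> mu = mum / (1 - beta) ->
  mu * nu <= 1 / 2 /\
  forall x w psi : int -> Omega -> 'rV[R]_M,
  let F := history w psi x in
  sgd g thetas mu init x ->
  momentum_sgd g thetas mum beta1 beta2 init w psi ->
  (forall (i : int) (v : Omega -> 'rV[R]_M), -1 <= i ->
     vec_measurable (v : g_sigma_algebraType (F (i - 1)) -> 'rV[R]_M) ->
     (forall k : 'I_M, condexp_eq0 P (F (i - 1)) (fun o => s i v o 0 k)) /\
     condexp_le P (F (i - 1)) (fun o => enorm (s i v o) ^+ 2)
       (fun o => gamma ^+ 2 * enorm (wo - v o) ^+ 2 + sigma ^+ 2)) ->
  (forall i : int, 0 <= i -> condexp_le P (F (i - 1))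
     (fun o => enorm (s i (psi (i - 1)) o - s i (x (i - 1)) o) ^+ 2)
     (fun o => xi1 * enorm (psi (i - 1) o - x (i - 1) o) ^+ 2)) ->
  forall i : nat, L2 P (fun o => w i%:Z o - x i%:Z o) /\
    msq P (fun o => w i%:Z o - x i%:Z o) <=
      K * mu ^+ 2 * ((1 - mu * nu / 2) ^+ i.+1 + sigma ^+ 2).
Proof.
have /andP[b0 b1] := beta01.
pose c := lag beta1 beta.
pose k1 := increment_gain beta1 beta nu delta.
pose k2 := deviation_gain delta gamma.
pose B := first_gradient_bound P init wo delta gamma sigma.
pose A := 2 * initial_msq P init wo + 2 * B + 1.
have d20 := sqr_ge0 delta; have g20 := sqr_ge0 gamma; have c20 := sqr_ge0 c.
have m00 : 0 <= initial_msq P init wo by exact: msq_ge0.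
have B0 : 0 <= B.
  have h1 := mulr_ge0 d20 m00; have h2 := mulr_ge0 g20 m00.
  by rewrite /B /first_gradient_bound addr_ge0// mulr_ge0// addr_ge0// sqr_ge0.
have k10 : 0 <= k1.
  rewrite /k1 /increment_gain mulr_ge0// addr_ge0//; last by rewrite mulr_ge0// ltW.
  by rewrite divr_ge0 ?mulr_ge0// ltW.
have k20 : 0 <= k2 by rewrite /k2 /deviation_gain mulr_ge0// addr_ge0.
have k30 : 0 <= k2 * c ^+ 2 by exact: mulr_ge0.
have A0 : 0 < A by rewrite /A ltr_wpDl// addr_ge0// mulr_ge0.
have [D [E [D0 E0 BD BE [DA EK]]]] := recursion_constants nu0 b1 k10 k20 (ltW A0) B0.
have k1D : 0 <= k1 * D by exact: mulr_ge0.
have nuA : 0 < nu * A by exact: mulr_gt0.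
(* The smallness conditions of [drift_step], for the two noises, and of
   [coupled_recursion]; the second one also keeps [rho1] and [tau2] in the unit
   interval. *)
have [|mubar mubar0 small] := @small_step_exists R
  [:: (1, 1); (nu, 1 / 2); (delta ^+ 2 + gamma ^+ 2, nu / 4);
      (delta ^+ 2 + `|xi1|, nu / 4); (k2 * c ^+ 2 + nu / 2, (1 - beta) / 2);
      (k1 * D, nu * A / 2); (1, nu * A / 2)].
  have nu4 : 0 < nu / 4 by exact: divr_gt0.
  have k3nu : 0 <= k2 * c ^+ 2 + nu / 2 by rewrite addr_ge0// divr_ge0// ltW.
  have b2 : 0 < (1 - beta) / 2 by rewrite divr_gt0// subr_gt0.
  by rewrite /=; do ![apply/andP; split=> //];
    first [exact: ltW | exact: addr_ge0 | exact: divr_gt0].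
exists (2 * E + 2 * ((beta / (1 - beta)) ^+ 2 * D)), mubar.
split; first by rewrite addr_ge0// mulr_ge0// mulr_ge0// sqr_ge0.
split=> // mu mum muI muE; have /andP[mu0 _] := muI.
have /= := small _ muI; rewrite !andbT !mulr1.
move=> /and5P[mu1 munu smallg smallx /and3P[smallk3 smallD smallA]].
split; first by [].
move=> x w psi sgdx momw noise noise_diff i.
have mun : mu * nu <= 1.
  by apply: le_trans munu _; rewrite ler_pdivrMr// mul1r ler1n.
have noise0 j v j1 mv := (noise j v j1 mv).1.
have noise2 j v j1 mv := (noise j v j1 mv).2.
have ms j v : -1 <= j -> adapted x w psi (j - 1) v -> vec_measurable (s j v).
  by move=> j1 mv k; exact: (condexp_eq0_measurable (noise0 j v j1 mv k)).
have hA : 2 * initial_msq P init wo + 2 * first_gradient_bound P init wo delta gamma sigma <= A.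
  by rewrite lerDl.
exact: (iterates_close b1 betaD betaM muE sgdx momw cgrad minit ms mu0 nu0
  delta0 beta01 mono lip grad_wo Linit noise0 noise2 noise_diff smallg smallx
  (ltW A0) D0 E0 mu1 mun smallk3 smallD smallA DA EK hA BD BE i).
Qed.

End main_estimate.

(** [x ^+ 2 <= 1 + x ^+ 4] turns the fourth moment into a second one. *)
Lemma initial_L2 d (T : measurableType d) (R : realType) (M : nat)
    (P : probability T R) (v : T -> 'rV[R]_M) (a : 'rV[R]_M) :
  vec_measurable v -> (\int[P]_o (enorm (v o) ^+ 4)%:E < +oo)%E ->
  L2 P (fun o => v o - a).
Proof.
move=> mv fin; apply: L2B; last exact: L2_cst.
split=> //; have mn := measurable_nsq mv.
have E4 o : enorm (v o) ^+ 4 = nsq (v o) ^+ 2 by rewrite /nsq -exprM.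
have i4 : P.-integrable [set: T] (EFin \o (fun o => nsq (v o) ^+ 2)).
  apply/integrableP; split; first by apply/measurable_EFinP; exact: measurable_funX.
  apply: le_lt_trans fin; rewrite le_eqVlt; apply/orP; left; apply/eqP.
  by apply: eq_integral => o _; rewrite /= E4 ger0_norm ?sqr_ge0.
apply: (@le_integrable_EFin _ _ _ P _ (fun o => 1 + nsq (v o) ^+ 2)) => //.
- move=> o; rewrite ger0_norm ?nsq_ge0//.
  have := sqr_ge0 (nsq (v o) - 1); have := nsq_ge0 (v o); rewrite sqrrB1; lra.
- by apply: integrable_EFinD => //; exact: integrable_EFin_cst.
Qed.

(** The dimension must be positive: in dimension zero the two Loewner bounds
    hold for all [nu] and [delta]. *)
Lemma hess_bounds_le (R : realType) (M : nat) (J : 'rV[R]_M.+1 -> R) nu delta :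
  (forall w, loewner_le nu%:M (hess J w) /\ loewner_le (hess J w) delta%:M) ->
  nu <= delta.
Proof.
move=> H; pose e : 'rV[R]_M.+1 := delta_mx 0 0.
have := le_trans (hess_ge H 0 e) (hess_le H 0 e).
suff -> : nsq e = 1 by rewrite !mulr1.
rewrite nsqE (bigD1 ord0)//= big1 ?addr0 ?mxE ?eqxx ?expr1n// => k k0.
by rewrite mxE (negbTE k0) andbF expr0n.
Qed.

Theorem theorem11 (R : realType) (M : nat)
    (d d' : measure_display) (Omega : measurableType d)
    (Theta : measurableType d') (P : probability Omega R)
    (Q : 'rV[R]_M -> Theta -> R)
    (theta : {RV P >-> Theta}) (thetas : int -> {RV P >-> Theta})
    (J : 'rV[R]_M -> R) (wo : 'rV[R]_M) (init : Omega -> 'rV[R]_M)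
    (nu delta gamma4 sigma4 gamma sigma beta1 beta2 beta epsilon
     xi1 xi2 kappa : R)
    (* loss, data, risk and minimizer *)
    (hQmeas : jointly_measurable Q)
    (hQdiff : forall t w, differentiable (Q^~ t) w)
    (hQint : forall w,
       P.-integrable [set: Omega] (fun o => (Q w (theta o))%:E))
    (hsamples : forall (i : int) (A : set Theta), -1 <= i -> measurable A ->
       distribution P (thetas i) A = distribution P theta A)
    (hJ : forall w, J w = risk P Q theta w)
    (hwo : forall w, J wo <= J w)
    (* initial state *)
    (hinit : vec_measurable init)
    (hinit4 : (\int[P]_o (enorm (init o) ^+ 4)%:E < +oo)%E)
    (* (i) *)
    (hJdiff : twice_differentiable J)
    (hnu : 0 < nu)
    (hhess : forall w, loewner_le nu%:M (hess J w) /\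
                       loewner_le (hess J w) delta%:M)
    (* (ii), constants *)
    (hgamma4 : 0 <= gamma4) (hsigma4 : 0 <= sigma4)
    (hgamma : 0 <= gamma) (hsigma : 0 <= sigma)
    (* (iii) *)
    (hbeta1 : 0 <= beta1 < 1) (hbeta2 : 0 <= beta2 < 1)
    (hbetaD : beta1 + beta2 = beta) (hbetaM : beta1 * beta2 = 0)
    (hbeta : 0 <= beta < 1)
    (hepsilon : 0 < epsilon) (hbetaepsilon : beta <= 1 - epsilon)
    (* (vi) *)
    (hkappa : 0 <= kappa)
    (hhesslip : forall w1 w2,
       opnorm (hess J w1 - hess J w2) <= kappa * enorm (w1 - w2)) :
  exists C mubar : R, 0 < C /\ 0 < mubar /\
  forall mu mum : R, 0 < mu < mubar ->
  (* (iv) *)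
  mu = mum / (1 - beta) ->
  forall x w psi : int -> Omega -> 'rV[R]_M,
  let g := fun v t => grad (Q^~ t) v in
  let s := gradient_noise Q J thetas in
  let F := history w psi x in
  sgd g thetas mu init x ->
  momentum_sgd g thetas mum beta1 beta2 init w psi ->
  (* (ii) *)
  (forall (i : int) (v : Omega -> 'rV[R]_M), -1 <= i ->
     vec_measurable (v : g_sigma_algebraType (F (i - 1)) -> 'rV[R]_M) ->
     [/\ forall k : 'I_M, condexp_eq0 P (F (i - 1)) (fun o => s i v o 0 k),
         condexp_le P (F (i - 1)) (fun o => enorm (s i v o) ^+ 4)
           (fun o => gamma4 ^+ 4 * enorm (wo - v o) ^+ 4 + sigma4 ^+ 4)
       & condexp_le P (F (i - 1)) (fun o => enorm (s i v o) ^+ 2)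
           (fun o => gamma ^+ 2 * enorm (wo - v o) ^+ 2 + sigma ^+ 2)]) ->
  (* (v) *)
  (forall i : int, 0 <= i ->
     condexp_le P (F (i - 1))
       (fun o => enorm (s i (psi (i - 1)) o - s i (x (i - 1)) o) ^+ 2)
       (fun o => xi1 * enorm (psi (i - 1) o - x (i - 1) o) ^+ 2) /\
     condexp_le P (F (i - 1))
       (fun o => enorm (s i (psi (i - 1)) o - s i (x (i - 1)) o) ^+ 4)
       (fun o => xi2 * enorm (psi (i - 1) o - x (i - 1) o) ^+ 4)) ->
  let rho1 := 1 - mu * nu / 2 in
  let tau2 := Num.sqrt (1 - mu * nu / 4) in
  0 < rho1 < 1 /\ 0 < tau2 < 1 /\
  forall i : nat,
    ('E_P[fun o => (enorm ((wo - w (i%:Z) o) - (wo - x (i%:Z) o)) ^+ 2)%R]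
     <= (C * (delta ^+ 2 * sigma ^+ 2 * i%:R ^+ 2 * tau2 ^+ i.+1
                * mu `^ (3 / 2) / ((1 - beta) * nu `^ (5 / 2))
              + ((delta ^+ 2 + gamma ^+ 2) * rho1 ^+ i.+1 / (1 - beta) ^+ 2
                 + delta ^+ 2 * sigma ^+ 4 / ((1 - beta) * nu ^+ 2))
                * mu ^+ 2))%:E)%E.


Proof.
have cgrad : continuous (grad J).
  by move=> v; apply: differentiable_continuous; exact: (hJdiff v).2.
have mono := grad_strongly_monotone hJdiff hhess.
have grad_wo := grad_min0 hJdiff hwo.
have Linit := initial_L2 wo hinit hinit4.
have b1 : 0 < 1 - beta by rewrite subr_gt0; case/andP: hbeta.
(* In dimension zero [delta] may fail to be positive; any positive constant is
   then a Lipschitz constant. *)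
have [delta' [delta'0 lip deltaE]] : exists delta', [/\ 0 < delta',
    forall a b, nsq (grad J a - grad J b) <= delta' ^+ 2 * nsq (a - b) &
    (0 < M)%N -> delta' = delta].
  clear - hhess hnu hJdiff.
  case: M J hJdiff hhess => [|m] J hJdiff hhess.
    by exists 1; split=> // a b; rewrite !nsqE !big_ord0 mulr0.
  have delta0 : 0 < delta := lt_le_trans hnu (hess_bounds_le hhess).
  by exists delta; split=> //; exact: grad_lipschitz.
have [K [mubar [K0 [mubar0 close]]]] := momentum_close_to_sgd Q thetas gamma
  sigma xi1 hnu delta'0 hbeta hbetaD hbetaM mono lip cgrad grad_wo hinit Linit.
pose a1 := (delta ^+ 2 + gamma ^+ 2) / (1 - beta) ^+ 2.
pose a2 := delta ^+ 2 * sigma ^+ 4 / ((1 - beta) * nu ^+ 2).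
have a10 : 0 <= a1 by rewrite divr_ge0 ?sqr_ge0// addr_ge0// sqr_ge0.
have a20 : 0 <= a2.
  apply: divr_ge0; first by apply: mulr_ge0; [exact: sqr_ge0 | exact: exprn_ge0].
  by apply: mulr_ge0; [exact: ltW | exact: sqr_ge0].
have Ka1 : 0 <= K / a1 by exact: divr_ge0.
have Ka2 : 0 <= K * sigma ^+ 2 / a2.
  by apply: divr_ge0 => //; apply: mulr_ge0 => //; exact: sqr_ge0.
(* If [sigma = 0] then [a2 = 0], and the second quotient is [0]: the steady-state
   error vanishes on both sides. *)
exists (K / a1 + K * sigma ^+ 2 / a2 + 1), mubar.
split; first by rewrite ltr_wpDl// addr_ge0.
split=> // mu mum muI muE x w psi g s F sgdx momw noise noise_diff rho1 tau2.
have [munu /(_ x w psi sgdx momw) {}close] := close mu mum muI muE.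
have /andP[mu0 _] := muI.
have munu0 : 0 < mu * nu by exact: mulr_gt0.
have rho01 : 0 < rho1 < 1 by apply/andP; rewrite /rho1; split; lra.
split=> //; split.
  rewrite /tau2 sqrtr_gt0 -[X in _ && (_ < X)]sqrtr1 ltr_sqrt//.
  by apply/andP; split; lra.
move=> i.
have [|j j0|Lwx le_wx] := close _ _ i.
- by move=> j v j1 mv; have [h0 _ h2] := noise j v j1 mv.
- by have [] := noise_diff j j0.
have -> : ('E_P[fun o => (enorm ((wo - w i%:Z o) - (wo - x i%:Z o)) ^+ 2)%R] =
    (msq P (fun o => w i%:Z o - x i%:Z o))%:E)%E.
  rewrite /msq /Rintegral fineK; last exact: integrable_fin_num Lwx.2.
  rewrite unlock; apply: eq_integral => o _.
  by rewrite opprB addrC addrA subrK -[in RHS]opprB nsqN.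
rewrite lee_fin.
set T1 := delta ^+ 2 * sigma ^+ 2 * _ * _ * _ / _.
have T10 : 0 <= T1.
  apply: divr_ge0; last by apply: mulr_ge0; [exact: ltW | exact: powR_ge0].
  do 4?[apply: mulr_ge0]; rewrite ?sqr_ge0 ?powR_ge0//.
  by apply: exprn_ge0; exact: sqrtr_ge0.
set C := _ + _ + 1.
have C0 : 0 <= C by rewrite /C !addr_ge0.
have q0 : 0 <= rho1 ^+ i.+1 by rewrite exprn_ge0// ltW; case/andP: rho01.
have m20 := sqr_ge0 mu.
have CT1 : 0 <= C * T1 by exact: mulr_ge0.
set rhs2 := (_ / _ + _) * mu ^+ 2.
have rhs2E : rhs2 = (a1 * rho1 ^+ i.+1 + a2) * mu ^+ 2.
  by rewrite /rhs2 /a1 mulrAC.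
have rhs20 : 0 <= rhs2.
  by rewrite rhs2E; apply: mulr_ge0 => //; apply: addr_ge0 => //; exact: mulr_ge0.
have [M0|M0] := posnP M.
  have -> : msq P (fun o => w i%:Z o - x i%:Z o) = 0.
    rewrite /msq; under eq_Rintegral => o _.
      rewrite nsqE big1; last by move=> k _; by have := ltn_ord k; rewrite [X in (_ < X)%N]M0.
      over.
    by rewrite Rintegral_cst// mul0r.
  by apply: mulr_ge0 => //; exact: addr_ge0.
have delta0 : 0 < delta by rewrite -(deltaE M0).
have a1_gt0 : 0 < a1.
  by rewrite divr_gt0 ?exprn_gt0// ltr_pwDl ?exprn_gt0// sqr_ge0.
have Ca1 : K <= C * a1.
  rewrite /C !mulrDl divfK ?gt_eqF// mul1r -addrA lerDl addr_ge0// mulr_ge0//.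
have Ca2 : K * sigma ^+ 2 <= C * a2.
  have [s0|s0] := eqVneq sigma 0.
    by rewrite {1}s0 expr0n mulr0 mulr_ge0.
  have a2_gt0 : 0 < a2.
    apply: divr_gt0; last by apply: mulr_gt0 => //; exact: exprn_gt0.
    by apply: mulr_gt0; apply: exprn_gt0 => //; rewrite lt0r s0.
  rewrite /C !mulrDl divfK ?gt_eqF// mul1r addrAC lerDr addr_ge0// mulr_ge0//.
apply: le_trans le_wx _; rewrite [leRHS]mulrDr -/rho1.
apply: (@le_trans _ _ (C * rhs2)); last by rewrite lerDr.
rewrite rhs2E mulrA mulrAC ler_wpM2r// !mulrDr mulrA.
by apply: lerD => //; exact: ler_wpM2r.
Qed.
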